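(* Let $\mathcal{G}$ be a finite connected graph with positive conductances $C$ and killing rates $\kappa\ge0$, transition matrix $P$, loop measure $\mu$, and let $\mathcal{L}$ be the Poisson point process of loops with intensity $\mu$. As $\gamma$ varies in the set of geodesic loops of $\mathcal{G}$ not homotopic to a point (i.e. the set of non-trivial conjugacy classes of the fundamental group), the numbers $|\{l\in\mathcal{L}:\ l^g=\gamma\}|$ are independent Poisson random variables with mean values $$\mu_\gamma=\frac{1}{\mathrm{mult}(\gamma)}\prod_{e\ \text{edge of}\ \gamma}P^{e^-}_{e^+}\,\rho^{e^-,e^+},$$ where the product runs over all the successive oriented edges $e=(e^-,e^+)$ traversed by $\gamma$, counted with the number of times they are traversed.
   Context: Graph and loops: $\mathcal{G}$ is a finite connected non-oriented graph with vertex set $X$ and edge set $E$, with no loop edges and no multiple edges. A based loop is a path $(x_0,x_1,\dots,x_{n-1},x_0)$, $n\ge1$, along edges; a loop is an equivalence class of based loops under cyclic shift. $\mathrm{mult}(l)$ is the largest integer $m$ such that a based loop representing $l$ is the concatenation of $m$ identical based loops. A geodesic loop is the class, under cyclic shift, of non-backtracking based loops which are also tailless (the first edge differs from the opposite of the last edge). Each loop $l$ is homotopic to a unique geodesic loop $l^g$ (obtained by erasing all backtracking parts); geodesic loops are in canonical bijection with conjugacy classes of the fundamental group. Markov chain and loop measure: conductances $C_{x,y}=C_{y,x}>0$ on edges ($C_{x,y}=0$ if $\{x,y\}\notin E$), killing rates $\kappa_x\ge0$, $\lambda_x=\kappa_x+\sum_yC_{x,y}$, $P^x_y=C_{x,y}/\lambda_x$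 (the chain jumps from $x$ to $y$ with probability $P^x_y$ and is killed at $x$ with probability $\kappa_x/\lambda_x$). The loop measure is $\mu(l)=\frac{1}{\mathrm{mult}(l)}\prod_{\text{edges }e\text{ of }l}P^{e^-}_{e^+}$, the product being over all edge traversals of $l$. The quantities $r^{x,y}$, $\rho^{x,y}$: for adjacent vertices $x,y$, $r^{x,y}$ is the probability that the Markov chain started at $y$ does not go to $x$ at its first step and returns to $y$ following a tree-contour subloop; precisely, it is the sum of $\prod_{k}P^{y_{k}}_{y_{k+1}}$ over all paths $(y_0=y,y_1,\dots,y_n=y)$, $n\ge1$, in $\mathcal{G}$ with $y_1\ne x$ whose lift to the universal cover of $\mathcal{G}$ returns to its starting point for the first time at time $n$. These satisfy $r^{x,y}=\sum_{z\neq x}P^y_zP^z_y\sum_{n\ge0}[r^{y,z}]^n$. Finally $\rho^{x,y}=\sum_{n=0}^\infty[r^{x,y}]^n$. *)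

(* Defs.v *)
From HB Require Import structures.
From Stdlib Require Import Relation_Operators.
From mathcomp Require Import all_boot all_order all_algebra generic_quotient.
From mathcomp Require Import all_classical all_reals all_analysis measurable_realfun.

Set Implicit Arguments.
Unset Strict Implicit.
Unset Printing Implicit Defensive.

Import Order.TTheory GRing.Theory Num.Theory.

Local Open Scope classical_set_scope.
Local Open Scope ring_scope.
Local Open Scope quotient_scope.

Section Loops.
Variables (X : finType) (E : rel X).

(* The based loop (x_0, x_1, .., x_(n-1), x_0) is stored as the sequence
   [:: x_0; ..; x_(n-1)]; [cycle] also checks the closing edge. *)
Definition based_loop := {s : seq X | (s != [::]) && cycle E s}.

Definition shift_equiv (s t : based_loop) : bool :=
  `[< exists i, rot i (val s) = val t >].

Lemma shift_equiv_refl : reflexive shift_equiv.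
Proof. by move=> s; apply/asboolP; exists 0%N; rewrite rot0. Qed.

Lemma shift_equiv_sym : symmetric shift_equiv.
Proof.
suff H (s t : based_loop) : shift_equiv s t -> shift_equiv t s.
  by move=> s t; apply/idP/idP; apply: H.
move=> /asboolP [i ist]; apply/asboolP.
by exists (size (rot i (val s)) - i)%N; rewrite -ist; exact: rotK.
Qed.

Lemma shift_equiv_trans : transitive shift_equiv.
Proof.
move=> t s u /asboolP [i ist] /asboolP [j jtu]; apply/asboolP.
by exists (rot_add (val s) i j); rewrite -rot_rot_add ist.
Qed.

Canonical shift_equiv_equiv :=
  EquivRel shift_equiv shift_equiv_refl shift_equiv_sym shift_equiv_trans.

Definition loop := {eq_quot shift_equiv}.

(* The notions below are read off the representative [repr l]; they do not
   depend on it, up to a cyclic shift for [loop_edges]. *)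
Definition loop_seq (l : loop) : seq X := val (repr l).

(* The successive oriented edges (x_0,x_1), .., (x_(n-1),x_0), repeated as many
   times as they are traversed. *)
Definition loop_edges (l : loop) : seq (X * X) :=
  zip (loop_seq l) (rot 1 (loop_seq l)).

Definition loop_mult (l : loop) : nat :=
  \max_(m < (size (loop_seq l)).+1 |
        `[< exists t : based_loop, loop_seq l = flatten (nseq m (val t)) >]) m.

(* Non-backtracking: no edge is followed by its opposite.  [cycle] also compares
   the last edge with the first one, which is the tailless condition. *)
Definition geodesic (l : loop) : bool :=
  cycle [rel a b : X * X | b != (a.2, a.1)] (loop_edges l).

(* As based loops have length at least 1, the constant loops are not of this
   type: these are the geodesic loops that are not homotopic to a point. *)
Definition geodesic_loop := {l : loop | geodesic l}.

Definition erase_backtrack (l l' : loop) : Prop :=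
  exists (s s' : based_loop) (x y : X) (t : seq X),
    [/\ val s = [:: x, y, x & t], val s' = x :: t,
        \pi_loop s = l & \pi_loop s' = l'].

Definition homotopic : loop -> loop -> Prop :=
  clos_refl_sym_trans loop erase_backtrack.

(* [None] stands for the constant loops, and is the value of [loop_geodesic] at
   the loops homotopic to a point. *)
Definition loop_geodesic (l : loop) : option geodesic_loop :=
  xget None (Some @` [set g : geodesic_loop | homotopic l (val g)]).

(* Universal cover based at y: its vertices are the non-backtracking paths from
   y, written with their endpoint first; each one is adjacent to its one-edge
   extensions, and the covering map sends a path to its endpoint. *)
Definition cover_step (p : seq X) (z : X) : seq X :=
  if p is _ :: u :: q then if z == u then u :: q else z :: p else z :: p.

(* The positions at times 1, .., n of the lift of (y, s_1, .., s_n). *)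
Definition cover_lift (y : X) (s : seq X) : seq (seq X) := scanl cover_step [:: y] s.

(* s is the path (y, s_1, .., s_n), with its starting point y omitted. *)
Definition tree_excursion (x y : X) (s : seq X) : bool :=
  [&& path E y s, s != [::], head y s != x &
      (index [:: y] (cover_lift y s)).+1 == size s].

End Loops.

Section Chain.
Variables (R : realType) (X : finType) (E : rel X).
Variables (C : X -> X -> R) (kappa : X -> R).

Definition total_rate (x : X) : R := kappa x + \sum_(y : X) C x y.

Definition trans_prob (x y : X) : R := C x y / total_rate x.

Definition loop_measure (l : loop E) : R :=
  (loop_mult l)%:R^-1 * \prod_(a <- loop_edges l) trans_prob a.1 a.2.

Definition path_weight (y : X) (s : seq X) : R :=
  \prod_(a <- zip (belast y s) s) trans_prob a.1 a.2.

Local Open Scope ereal_scope.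

Definition excursion_weight (x y : X) : \bar R :=
  \esum_(s in [set s | tree_excursion E x y s]) (path_weight y s)%:E.

Definition rho (x y : X) : \bar R :=
  \sum_(0 <= n <oo) excursion_weight x y ^+ n.

Definition geodesic_mean (g : loop E) : \bar R :=
  ((loop_mult g)%:R^-1)%:E *
  \prod_(a <- loop_edges g) ((trans_prob a.1 a.2)%:E * rho a.1 a.2).

End Chain.

Section Poisson.
Local Open Scope ereal_scope.
Context {d : measure_display} {Omega : measurableType d} {R : realType}.
Variable Pr : probability Omega R.

Definition independent_variables (I : choiceType) (Y : I -> Omega -> \bar R) :=
  (forall i, measurable_fun [set: Omega] (Y i)) /\
  forall (s : seq I) (B : I -> set (\bar R)),
    uniq s -> (forall i, measurable (B i)) ->
    Pr (\bigcap_(i in [set` s]) (Y i @^-1` B i)) =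
    \prod_(i <- s) Pr (Y i @^-1` B i).

(* Poisson law of mean m, with the usual convention that it is the Dirac mass
   at +oo for m = +oo.  The second argument of [poisson_prob] is a dummy. *)
Definition poisson_variable (Y : Omega -> \bar R) (m : \bar R) : Prop :=
  match m with
  | r%:E => (0 <= r)%R /\
      forall k : nat, Pr [set w | Y w = k%:R%:E] = poisson_prob r 0 [set k]
  | +oo => Pr [set w | Y w = +oo] = 1
  | -oo => False
  end.

(* A random multiset of points of T is given by the multiplicities N t w. *)
Definition point_count (T : choiceType) (N : T -> Omega -> nat) (A : set T)
    (w : Omega) : \bar R :=
  \esum_(t in A) (N t w)%:R%:E.

(* Poisson point process on a discrete space T, whose intensity gives the mass
   mu t to the point t. *)
Definition poisson_point_process (T : choiceType) (mu : T -> R)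
    (N : T -> Omega -> nat) : Prop :=
  [/\ forall t, measurable_fun [set: Omega] (N t),
      forall A : set T,
        poisson_variable (point_count N A) (\esum_(t in A) (mu t)%:E) &
      forall (n : nat) (A : 'I_n -> set T), trivIset [set: 'I_n] A ->
        independent_variables (fun i => point_count N (A i))].

End Poisson.

(* Main.v *)
Require Import Defs.
From Stdlib Require Import Relation_Operators.
From mathcomp Require Import all_boot all_order all_algebra generic_quotient.
From mathcomp Require Import zify.
From mathcomp Require Import all_classical all_reals all_analysis.

(* Count, among the rotations of a based loop s of length n, those whose lift to
   the universal cover starts with a last exit: it never comes back to its
   starting point, and ends at the endpoint of the lift of a fixed based
   representative of the geodesic loop gamma.  Erasing a backtrack of s does not
   change this number, which is mult gamma for gamma itself; so it is mult gamma
   for every loop homotopic to gamma.  Since a loop l has n / mult l based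
   representatives, the measure of the loops homotopic to gamma is
   1 / mult gamma times the weight of the based loops of the above kind.

   Cutting such a based loop at the last exits from the successive vertices of
   the lift of gamma writes it uniquely as the edges of gamma, each edge (x, y)
   being followed by a sequence of excursions at y that avoid x in the cover:
   this is the factor P x y * rho x y.  The excursions at y form a prefix-free
   set of paths whose first step is not x, so their total weight is at most
   1 - P y x < 1 and rho is finite. *)

Set Implicit Arguments.
Unset Strict Implicit.
Unset Printing Implicit Defensive.

Import Order.TTheory GRing.Theory Num.Theory.

Local Open Scope classical_set_scope.
Local Open Scope ring_scope.
Local Open Scope quotient_scope.

Lemma cat_injr (T : eqType) (s1 s2 s3 : seq T) : s1 ++ s3 = s2 ++ s3 -> s1 = s2.
Proof.
move=> e; have /eqP := congr1 rev e; rewrite !rev_cat eqseq_cat //.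
by case/andP => _ /eqP /(can_inj revK).
Qed.

(** * Lifts to the universal cover and last exits *)

Section CoverLift.
Local Open Scope nat_scope.
Variable X : finType.
Implicit Types (x y z : X) (p q b c s t : seq X).

Definition lift_end p c := foldl (@cover_step X) p c.

Definition lift_path p c := scanl (@cover_step X) p c.

(** The starting position [p] is not tested, so [above 1 [:: y] c] means that the lift of [c] never
    comes back to its start. *)
Definition above h p c := all (fun r => h < size r) (lift_path p c).

Fixpoint reduced p : bool :=
  match p with
  | a :: ((b :: c :: _) as p') => (a != c) && reduced p'
  | _ => true
  end.

Lemma lift_end_cat p c1 c2 :
  lift_end p (c1 ++ c2) = lift_end (lift_end p c1) c2.
Proof. exact: foldl_cat. Qed.

Lemma lift_path_cat p c1 c2 :
  lift_path p (c1 ++ c2) = lift_path p c1 ++ lift_path (lift_end p c1) c2.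
Proof. exact: scanl_cat. Qed.

Lemma above_cat h p c1 c2 :
  above h p (c1 ++ c2) = above h p c1 && above h (lift_end p c1) c2.
Proof. by rewrite /above lift_path_cat all_cat. Qed.

Lemma above_cons h p z c :
  above h p (z :: c) = (h < size (cover_step p z)) && above h (cover_step p z) c.
Proof. by []. Qed.

Lemma above_rcons h p c z :
  above h p (rcons c z) = (h < size (lift_end p (rcons c z))) && above h p c.
Proof. by rewrite /above /lift_path scanl_rcons all_rcons. Qed.

Lemma lift_path_last p c : last p (lift_path p c) = lift_end p c.
Proof. by elim: c p => //= z c IH p; rewrite IH. Qed.

Lemma above_end h p c : h < size p -> above h p c -> h < size (lift_end p c).
Proof.
move=> hp /allP pc; rewrite -lift_path_last.
have := mem_last p (lift_path p c); rewrite inE => /orP[/eqP -> //|]; exact: pc.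
Qed.

Lemma above_le h k p c : k <= h -> above h p c -> above k p c.
Proof. by move=> kh; apply: sub_all => r; apply: leq_ltn_trans. Qed.

Lemma cover_step_head p z : exists r, cover_step p z = z :: r.
Proof.
case: p => [|a [|u r]] /=; [by exists [::] | by exists [:: a] |].
by case: eqP => [->|_]; [exists r | exists [:: a, u & r]].
Qed.

Lemma lift_end_head p x c : exists r, lift_end (x :: p) c = last x c :: r.
Proof.
elim: c x p => [|z c IH] x p; first by exists p.
rewrite -[lift_end _ _]/(lift_end (cover_step (x :: p) z) c).
by have [r ->] := cover_step_head (x :: p) z; apply: IH.
Qed.

Lemma lift_end_rcons_head p c z : exists r, lift_end p (rcons c z) = z :: r.
Proof.
by rewrite -cats1 lift_end_cat /=; apply: cover_step_head.
Qed.

Lemma cover_step_bottom p x z :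
  exists r, cover_step (rcons p x) z = rcons r x.
Proof.
case: p => [|a [|u p]] /=; first by exists [:: z].
  by case: eqP => _; [exists [::] | exists [:: z; a]].
by case: eqP => _; [exists (u :: p) | exists [:: z, a, u & p]].
Qed.

Lemma lift_end_bottom p x c : exists r, lift_end (rcons p x) c = rcons r x.
Proof.
elim: c p => [|z c IH] p /=; first by exists p.
by have [r ->] := cover_step_bottom p x z; apply: IH.
Qed.

Lemma cover_step_reduced p z : reduced p -> reduced (cover_step p z).
Proof.
case: p => [|a [|u r]] //=; case: (altP (z =P u)) => [_ | zu].
  by case: r => // v r /andP[].
by move=> red; rewrite /= zu.
Qed.

Lemma lift_end_reduced p c : reduced p -> reduced (lift_end p c).
Proof.
by elim: c p => //= z c IH p red; apply/IH/cover_step_reduced.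
Qed.

(** If [y] is the parent of [x], reducedness ensures that the step back to [x] is an extension and
    not a second descent. *)
Lemma lift_backtrack x p y : reduced (x :: p) ->
  cover_step (cover_step (x :: p) y) x = x :: p.
Proof.
case: p => [|u [|v r]] /=; first by rewrite eqxx.
  by move=> _; case: (altP (y =P u)) => _ //=; rewrite eqxx.
case/andP=> xv _; case: (altP (y =P u)) => _ /=; last by rewrite eqxx.
by rewrite (negbTE xv).
Qed.

Lemma cover_step_size p z : size p <= (size (cover_step p z)).+1 /\
  size (cover_step p z) <= (size p).+1.
Proof.
case: p => [|a [|u r]] //=; case: eqP => //= _; split; lia.
Qed.

Lemma cover_step_up p z : size p < size (cover_step p z) ->
  cover_step p z = z :: p.
Proof. by case: p => [|a [|u r]] //=; case: eqP => //= _; lia. Qed.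

(** [cover_step] looks no deeper than the second letter, so [b] can be put below as long as each
    position from which a step is taken has two letters. The final position is free, whence
    [belast]. *)
Lemma lift_path_base p b c :
  all (fun r => 1 < size r) (belast p (lift_path p c)) ->
  lift_path (p ++ b) c = map (fun r => r ++ b) (lift_path p c).
Proof.
elim: c p => //= z c IH [|a [|u r]] //= /IH.
by case: eqP => _ /= <-.
Qed.

(** Here the hypothesis bears on the long lift: it never descends into [b], so from a single letter
    above [b] it can only extend, as from that letter alone. *)
Lemma lift_path_unbase x p b c : above (size b) (x :: p ++ b) c ->
  lift_path (x :: p ++ b) c = map (fun r => r ++ b) (lift_path (x :: p) c).
Proof.
elim: c x p => //= z c IH x p; rewrite above_cons => /andP[].
case: p => [|u p] /=.
  case: b IH => [|v b] IH /=; first by move=> _ /(IH z [:: x]) {1}->.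
  by case: eqP => /= _; [lia | move=> _ /(IH z [:: x]) {1}->].
case: eqP => _ /=; first by move=> _ /IH ->.
by move=> _ /(IH z (x :: u :: p)) ->.
Qed.

Lemma lift_end_base p b c :
  lift_path (p ++ b) c = map (fun r => r ++ b) (lift_path p c) ->
  lift_end (p ++ b) c = lift_end p c ++ b.
Proof. by move=> H; rewrite -!lift_path_last H (last_map (fun r => r ++ b)). Qed.

Lemma lift_end_unbase x p b c : above (size b) (x :: p ++ b) c ->
  lift_end (x :: p ++ b) c = lift_end (x :: p) c ++ b.
Proof. by move=> /lift_path_unbase /(@lift_end_base (x :: p)). Qed.

Lemma above_base h p b c :
  lift_path (p ++ b) c = map (fun r => r ++ b) (lift_path p c) ->
  above (h + size b) (p ++ b) c = above h p c.
Proof.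
rewrite /above => ->; rewrite all_map; apply: eq_all => r /=.
by rewrite size_cat ltn_add2r.
Qed.

Lemma belast_above h p c : h < size p -> above h p c ->
  all (fun r => h < size r) (belast p (lift_path p c)).
Proof.
move=> hp; rewrite /above; case: (lift_path p c) => // q l /= H.
have : all (fun r => h < size r) (p :: q :: l) by rewrite /= hp.
by rewrite lastI all_rcons => /andP[].
Qed.

(** The height changes by at most one at each step, so the last position of height at most [h] has
    height exactly [h] and is left by an extension. *)
Lemma last_exit h p c :
  has (fun r => size r <= h) (p :: lift_path p c) -> h < size (lift_end p c) ->
  exists c1 z c2, [/\ c = c1 ++ z :: c2, size (lift_end p c1) = h,
    cover_step (lift_end p c1) z = z :: lift_end p c1 &
    above h (lift_end p c1) (z :: c2)].
Proof.
elim: c p => [|z c IH] p; first by rewrite /= orbF leqNgt => /negbTE /= ->.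
case: (boolP (has (fun r => size r <= h)
   (cover_step p z :: lift_path (cover_step p z) c))) => [hs _ /(IH _ hs) | nhs].
  by move=> [c1 [z' [c2 [-> ? ? ?]]]]; exists (z :: c1), z', c2.
have ab : above h p (z :: c).
  apply/allP => r rin; rewrite ltnNge; apply: contra nhs => rh.
  by apply/hasP; exists r.
case/orP => [ph _|H]; last by case/negP: nhs.
exists [::], z, c.
have [] := andP ab => hz _; have [_ sz] := cover_step_size p z.
have ph' : size p = h by apply/eqP; rewrite eqn_leq ph -ltnS (leq_trans hz sz).
by split => //=; apply: cover_step_up; rewrite ph'.
Qed.

(** After the last exit from height [size q] the lift remains above the vertex it left, which is
    therefore a suffix of [x :: q], hence [q]. *)
Lemma last_exit_to p q x c : size p <= size q -> lift_end p c = x :: q ->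
  exists c1 c2, [/\ c = c1 ++ x :: c2, lift_end p c1 = q,
    cover_step q x = x :: q & above (size q) (x :: q) c2].
Proof.
move=> pq ec; have [] := @last_exit (size q) p c.
- by rewrite /= pq.
- by rewrite ec /=.
move=> c1 [z [c2 [e sc1 sz]]]; rewrite above_cons sz => /andP[_ ab].
have := @lift_end_unbase z [::] (lift_end p c1) c2; rewrite sc1 => /(_ ab).
rewrite -[z :: _]/(z :: lift_end p c1) -{1}sz.
rewrite -[lift_end (cover_step _ _) _]/(lift_end _ (z :: c2)) -lift_end_cat -e ec.
move=> fin; have sz2 : size (lift_end [:: z] c2) = 1.
  by have := congr1 size fin; rewrite size_cat sc1 /=; lia.
have ec1 : lift_end p c1 = q.
  by have := congr1 (drop 1) fin; rewrite /= drop0 drop_size_cat.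
have zx : z = x.
  have /eqP := fin; rewrite ec1 -cat1s eqseq_cat ?sz2 //.
  case/andP => /eqP e2 _; have [r2] := lift_end_bottom [::] z c2.
  by rewrite /= -e2 => /(@rcons_inj _ [::] r2 x z)[].
by rewrite zx in e sz ab; rewrite ec1 in sz ab; exists c1, c2.
Qed.

(** Of two different cuts, the later one would put the lift at height [h] after the earlier exit. *)
Lemma last_exit_unique h p c1 z c2 c1' z' c2' :
  c1 ++ z :: c2 = c1' ++ z' :: c2' ->
  size (lift_end p c1) = h -> size (lift_end p c1') = h ->
  above h (lift_end p c1) (z :: c2) -> above h (lift_end p c1') (z' :: c2') ->
  c1 = c1'.
Proof.
elim: c1 c1' p => [|a c1 IH] [|a' c1'] p //= [].
- move=> -> -> ph p'h; rewrite above_cons above_cat => /and3P[a1 a2 _] _.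
  by have := above_end a1 a2; rewrite p'h ltnn.
- move=> -> <- ph p'h _; rewrite above_cons above_cat => /and3P[a1 a2 _].
  by have := above_end a1 a2; rewrite ph ltnn.
- by move=> -> e ph p'h a1 a2; rewrite (IH _ _ e ph p'h a1 a2).
Qed.

Lemma lift_end_push x y p c : reduced (x :: y :: c) ->
  lift_end (y :: x :: p) c = rev c ++ y :: x :: p /\ above 1 (y :: x :: p) c.
Proof.
elim: c x y p => // z c IH x y p /andP[xz red].
have step : cover_step [:: y, x & p] z = [:: z, y, x & p].
  by rewrite /= eq_sym (negbTE xz).
rewrite above_cons -[lift_end _ _]/(lift_end (cover_step [:: y, x & p] z) c) step.
have [-> ->] := IH _ _ (x :: p) red.
by rewrite rev_cons cat_rcons.
Qed.

Lemma lift_end1_push y c : reduced (y :: c) ->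
  lift_end [:: y] c = rev (y :: c) /\ above 1 [:: y] c.
Proof.
case: c => // z c red; rewrite above_cons.
rewrite -[lift_end _ _]/(lift_end [:: z; y] c) -[cover_step _ _]/[:: z; y].
have [-> ->] := lift_end_push [::] red.
by rewrite !rev_cons -!cats1 -catA.
Qed.

Lemma reducedPn p : ~~ reduced p ->
  exists c1 x y c2, p = c1 ++ [:: x, y, x & c2].
Proof.
elim: p => //= a p IH; case: p IH => // b [|c p] //= IH.
rewrite negb_and negbK => /orP[/eqP <-|/IH]; first by exists [::], a, b, p.
by move=> [c1 [x [y [c2 ->]]]]; exists (a :: c1), x, y, c2.
Qed.

Lemma above1_first y z c x : above 1 [:: y] (z :: c) ->
  lift_end [:: y] (z :: c) = [:: x; y] -> z = x.
Proof.
move=> ab; have := @lift_end_unbase z [::] [:: y] c ab.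
rewrite -[lift_end [:: y] _]/(lift_end [:: z; y] c) => ->; have [r] := lift_end_bottom [::] z c.
rewrite /= => ->; rewrite -[[:: x; y]]/(rcons [:: x] y) cats1.
by move/rcons_inj => [] /(@rcons_inj _ r [::] z x)[].
Qed.

Lemma above1_bottom x y c : above 1 [:: x; y] c ->
  exists r, lift_end [:: x; y] c = r ++ [:: x; y].
Proof.
move=> ab; have := @lift_end_unbase x [::] [:: y] c ab.
rewrite /= => ->; have [r] := lift_end_bottom [::] x c.
by rewrite /= => ->; exists r; rewrite cat_rcons.
Qed.

End CoverLift.

(** * Invariance of the number of unfolding rotations *)

Section Unfolding.
Local Open Scope nat_scope.
Variable X : finType.
Implicit Types (x y z : X) (p q b c s t : seq X).

(* The cyclic sequence [s], closed up into a path from its first vertex, lifts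
   to a path of the universal cover that ends at [q] and never comes back to its
   starting point. *)
Definition unfolds q s : bool :=
  if s is y :: s' then
    (lift_end [:: y] (rcons s' y) == q) && above 1 [:: y] (rcons s' y)
  else false.

Definition nb_unfolds q s : nat := \sum_(i < size s) unfolds q (rot i s).

(** By [lift_backtrack] the inserted [y; x] brings the lift back where it was; the only new
    condition is that the inserted [y] does not lift to the starting point. *)
Lemma unfolds_backtrack q a t1 x y t2 :
  unfolds q (a :: t1 ++ [:: x, y, x & t2]) =
  unfolds q (a :: t1 ++ x :: t2) &&
  (1 < size (cover_step (lift_end [:: a] (rcons t1 x)) y)).
Proof.
rewrite /unfolds.
have -> : rcons (t1 ++ [:: x, y, x & t2]) a = rcons t1 x ++ [:: y; x] ++ rcons t2 a.
  by rewrite rcons_cat cat_rcons.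
have -> : rcons (t1 ++ x :: t2) a = rcons t1 x ++ rcons t2 a.
  by rewrite rcons_cat cat_rcons.
have red : reduced (lift_end [:: a] (rcons t1 x)) by apply: lift_end_reduced.
have [p' ep] := lift_end_rcons_head [:: a] t1 x.
have : above 1 [:: a] (rcons t1 x) -> 1 < size (x :: p').
  by rewrite above_rcons ep => /andP[].
rewrite !lift_end_cat !above_cat ep in red *.
have -> : lift_end (x :: p') [:: y; x] = x :: p' by exact: lift_backtrack.
rewrite !above_cons lift_backtrack //; case: (above 1 [:: a] (rcons t1 x)).
  move=> /(_ isT) ->; rewrite -[above 1 _ [::]]/true.
  by move: (_ == q) (above 1 _ _) (1 < _) => [] [] [].
by move=> _; rewrite !andFb !andbF.
Qed.

(** One step away from [q], which has more than two letters, the lift cannot be at its start, so a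
    backtrack at the end costs nothing. *)
Lemma unfolds_tail q x t y : 2 < size q ->
  unfolds q (x :: t ++ [:: x; y]) = unfolds q (x :: t).
Proof.
move=> q2; rewrite /unfolds.
have -> : rcons (t ++ [:: x; y]) x = rcons t x ++ [:: y; x].
  by rewrite rcons_cat cat_rcons.
have red : reduced (lift_end [:: x] (rcons t x)) by apply: lift_end_reduced.
have [p' ep] := lift_end_rcons_head [:: x] t x.
rewrite lift_end_cat above_cat ep in red *.
have -> : lift_end (x :: p') [:: y; x] = x :: p' by exact: lift_backtrack.
case: eqP => //= eq; rewrite !above_cons lift_backtrack // eq /= (ltnW q2) !andbT.
have [/(leq_trans q2) sq _] := cover_step_size q y.
by rewrite (sq : 1 < size (cover_step q y)) andbT.
Qed.

(* The rotation of [x :: t] that starts at position [i] of [t] loses its last exit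
   when [y; x] is inserted after [x], because the inserted [y] lifts to the
   starting point.  The rotation of [:: x, y, x & t] that starts at [y] makes up
   for this loss; see [sum_pivot]. *)
Definition pivot q x y t i : bool :=
  if drop i t is a :: t2 then
    unfolds q (a :: t2 ++ x :: take i t) &&
    (lift_end [:: a] (rcons t2 x) == [:: x; y])
  else false.

Lemma pivotP q x y t i : reflect
  (exists t1 t2, [/\ t = t1 ++ y :: t2, size t1 = i,
    lift_end [:: y] (rcons t2 x) = [:: x; y] /\ above 1 [:: y] (rcons t2 x) &
    lift_end [:: x; y] (rcons t1 y) = q /\ above 1 [:: x; y] (rcons t1 y)])
  (pivot q x y t i).
Proof.
have splitE a t1 t2 : rcons (t2 ++ x :: t1) a = rcons t2 x ++ rcons t1 a.
  by rewrite rcons_cat cat_rcons.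
apply: (iffP idP); last first.
  move=> [t1 [t2 [-> <- [e1 a1] [e2 a2]]]]; rewrite /pivot drop_size_cat //.
  by rewrite take_size_cat // /unfolds splitE lift_end_cat above_cat e1 e2 a1 a2 !eqxx.
rewrite /pivot; case dt: (drop i t) => [//|a t2] /andP[].
rewrite /unfolds splitE lift_end_cat above_cat => + /eqP e1.
(* The bottom letter of a lift is its starting vertex, so [a] is [y]. *)
have [r] := lift_end_bottom [::] a (rcons t2 x).
rewrite e1 -[[:: x; y]]/(rcons [:: x] y) => /rcons_inj[_ ya].
rewrite -ya in e1 dt *; rewrite -[rcons [:: x] y]/[:: x; y].
case/and3P => /eqP e2 a1 a2; exists (take i t), t2; split => //.
- by rewrite -dt cat_take_drop.
- rewrite size_take_min; apply/minn_idPl; rewrite leqNgt; apply/negP => /ltnW.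
  by move/drop_oversize; rewrite dt.
Qed.

(** The inserted [y] lifts to the starting point exactly when the lift stands at [[:: x; y]] just
    before, which is what [pivot] detects. *)
Lemma unfolds_pivot q x y t i : i < size t ->
  (unfolds q (rot i.+1 (x :: t)) =
   unfolds q (rot i.+3 [:: x, y, x & t]) + pivot q x y t i :> nat).
Proof.
move=> it; rewrite /pivot.
case dt: (drop i t) => [|a t2].
  by move: (size_drop i t); rewrite dt /= => /esym/eqP; rewrite subn_eq0 leqNgt it.
have -> : rot i.+1 (x :: t) = a :: t2 ++ x :: take i t by rewrite /rot /= dt.
have -> : rot i.+3 [:: x, y, x & t] = a :: t2 ++ [:: x, y, x & take i t].
  by rewrite /rot /= dt.
rewrite unfolds_backtrack.
case: (boolP (unfolds _ _)) => //= u.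
have [p' ep] := lift_end_rcons_head [:: a] t2 x.
have [r] := lift_end_bottom [::] a (rcons t2 x).
rewrite ep; case: p' ep => [|v [|w p']] ep; first by rewrite /= eqseq_cons andbF.
- by rewrite /= eqseq_cons eqxx /= eqseq_cons andbT; case: (altP (v =P y)) => [->|vy];
   rewrite 1?eq_sym ?eqxx ?(negbTE vy).
- by rewrite /= !eqseq_cons /= andbF /=; case: eqP; rewrite /= ?andbF.
Qed.


(** Vertices of the cover are written endpoint first: [y] and [x] are the first two vertices of the
    path, [u] the last but one. *)
Definition tailless q :=
  forall p x y z u r, q = p ++ [:: x; y] -> q = [:: z, u & r] -> x != u.

(** The path [rcons t2 x] begins with [x] by [above1_first], and by taillessness this step leads
    from [q] up to [x :: q]; the rest is the same lift translated from the root to [q]. *)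
Lemma pivot_exit q x y t1 t2 : tailless q -> 2 < size q ->
  lift_end [:: y] (rcons t2 x) = [:: x; y] -> above 1 [:: y] (rcons t2 x) ->
  lift_end [:: x; y] (rcons t1 y) = q -> above 1 [:: x; y] (rcons t1 y) ->
  lift_end q (rcons t2 x) = x :: q /\ above (size q) q (rcons t2 x).
Proof.
move=> tq q2 e1 a1 e2 a2.
have [q' eq'] := lift_end_rcons_head [:: x; y] t1 y; rewrite e2 in eq'.
have [r er] := above1_bottom a2; rewrite e2 in er.
case: q' eq' => [|u q'] eq'; first by rewrite eq' in q2.
have xu := tq _ _ _ _ _ _ er eq'.
case ec : (rcons t2 x) e1 a1 => [|z c2] e1 a1; first by case: (t2) ec.
have zx := above1_first a1 e1; rewrite {z}zx in ec e1 a1 *.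
have a1' : above 1 [:: x; y] c2 by move: a1; rewrite above_cons => /andP[].
have base := lift_path_base (u :: q') (@belast_above _ 1 [:: x; y] c2 isT a1').
have step : cover_step q x = x :: q by rewrite eq' /= (negbTE xu).
rewrite above_cons -[lift_end _ _]/(lift_end (cover_step q x) c2) step {1 3}eq'.
rewrite -[_ :: _]/([:: x; y] ++ u :: q') (lift_end_base base).
rewrite -[lift_end _ _]/(lift_end [:: y] (x :: c2)) e1 eq' /= ltnS leqnn.
split=> //; move: (@above_base _ 1 _ _ _ base); rewrite a1' /= => ab.
exact: ab.
Qed.

(** If the rotation based at [y] unfolds, its final step descends from [x :: q] to [q], and the last
    exit from [q] before it locates the one position counted by [pivot]. Conversely, [pivot_exit]
    rebuilds the lift. *)
Lemma sum_pivot q x y t : tailless q -> 2 < size q ->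
  \sum_(i < size t) pivot q x y t i = unfolds q [:: y, x & rcons t x].
Proof.
move=> tq q2; case: (boolP (unfolds _ _)) => [|nu].
  move=> u; have {u} : (lift_end [:: x; y] (rcons (rcons t x) y) == q) &&
    above 1 [:: x; y] (rcons (rcons t x) y) by exact: u.
  case/andP => /eqP eq1 ab.
  have [r er] := above1_bottom ab; rewrite eq1 in er.
  have [p' ep] := lift_end_rcons_head [:: x; y] t x.
  (* An ascending final step would make [x] the last but one vertex of [q], against taillessness. *)
  have eq2 : lift_end [:: x; y] (rcons t x) = x :: q.
    move: eq1; rewrite -cats1 lift_end_cat /= ep /=.
    case: p' ep => [|u p'] ep /=.
      by move=> eq1; rewrite -eq1 in q2.
    case: eqP => [_ -> //| _ eq1].
    by have := tq _ _ _ _ _ _ er (esym eq1); rewrite eqxx.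
  have [c1 [c2 [ec ec1 sz ab3]]] := @last_exit_to _ [:: x; y] _ _ _ (ltnW q2) eq2.
  have fin : lift_end (x :: q) c2 = x :: q by rewrite -{1}sz -eq2 ec lift_end_cat ec1.
  have ab2 : above (size q) q (x :: c2) by rewrite above_cons sz leqnn.
  case/lastP: c1 ec ec1 => [|t1 a] ec ec1.
    by rewrite -ec1 in q2.
  have ea : a = y.
    have [r1 e1] := lift_end_rcons_head [:: x; y] t1 a.
    have [r2 e2] := lift_end_rcons_head [:: x; y] (rcons t x) y.
    by move: e1; rewrite ec1 -eq1 e2 => -[].
  rewrite {a}ea in ec ec1.
  have [t2 et2] : exists t2, x :: c2 = rcons t2 x.
    have := congr1 (last x) ec; rewrite last_rcons last_cat /= => ex.
    by exists (belast x c2); rewrite lastI -ex.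
  have et : t = t1 ++ y :: t2.
    have := ec; rewrite et2 cat_rcons -rcons_cons -rcons_cat.
    by move=> /rcons_inj[].
  have it : size t1 < size t by rewrite et size_cat /= -addn1 leq_add2l.
  have pv : pivot q x y t (size t1).
    apply/pivotP; exists t1, t2; split=> //; last first.
      split => //; move: ab; rewrite ec rcons_cat above_cat.
      by case/andP.
    (* Beyond the exit the lift stays above [q = y :: q']; removing [q'] translates it to a lift
       from [[:: y]]. *)
    have [q' eq'] := lift_end_rcons_head [:: x; y] t1 y; rewrite ec1 in eq'.
    have un : above (size q') (x :: [:: y] ++ q') c2.
      by rewrite eq' in ab3; apply: above_le ab3; apply: leqnSn.
    rewrite -et2 above_cons -[lift_end _ _]/(lift_end [:: x; y] c2).
    rewrite -[cover_step _ _]/[:: x; y]; split.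
      have := lift_end_unbase un; rewrite -[x :: _]/[:: x, y & q'] -eq' fin eq'.
      by rewrite -[[:: x, y & q']]/([:: x; y] ++ q') => /cat_injr.
    rewrite -(@above_base _ 1 [:: x; y] q' c2 (lift_path_unbase un)) add1n.
    by rewrite eq' in ab3.
  (* Another pivot position would be another last exit from [q]. *)
  rewrite (bigD1 (Ordinal it)) //= pv big1 // => i ni.
  apply/eqP; rewrite eqb0; apply/negP => /pivotP.
  move=> [t1' [t2' [et' si [e1' a1'] [e2' a2']]]].
  have [_ a3'] := pivot_exit tq q2 e1' a1' e2' a2'.
  have [z [c2' ec']] : exists z c2', rcons t2' x = z :: c2'.
    by case: (t2') => [|z c2']; [exists x, [::] | exists z, (rcons c2' x)].
  have : rcons t1 y = rcons t1' y.
    apply: (@last_exit_unique _ (size q) [:: x; y] _ x c2 _ z c2').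
    - by rewrite et2 -ec' !cat_rcons -!rcons_cons -!rcons_cat -et -et'.
    - by rewrite ec1.
    - by rewrite e2'.
    - by rewrite ec1.
    - by rewrite e2' -ec'.
  move/rcons_inj => -[e]; case/eqP: ni; apply: val_inj.
  by rewrite /= -si e.
rewrite big1 // => i _; apply/eqP; rewrite eqb0; apply: contra nu.
case/pivotP => t1 [t2 [et _ [e1 a1] [e2 a2]]].
have [e3 a3] := pivot_exit tq q2 e1 a1 e2 a2.
have [q' eq'] := lift_end_rcons_head [:: x; y] t1 y; rewrite e2 in eq'.
have ec : rcons (rcons t x) y = rcons t1 y ++ rcons t2 x ++ [:: y].
  by rewrite et cats1 cat_rcons !rcons_cat.
suff : (lift_end [:: x; y] (rcons (rcons t x) y) == q) &&
  above 1 [:: x; y] (rcons (rcons t x) y) by [].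
rewrite ec !lift_end_cat !above_cat a2 e2 e3.
rewrite (above_le (ltnW (ltnW q2)) a3) andTb.
by rewrite above_cons eq' /= !eqxx /= -eq'; move: q2; rewrite eq' => /ltnW ->.
Qed.

Lemma nb_unfolds_rot q k s : nb_unfolds q (rot k s) = nb_unfolds q s.
Proof.
have rot1E u : nb_unfolds q (rot 1 u) = nb_unfolds q u.
  case: u => // a u; rewrite /nb_unfolds size_rot.
  rewrite -[size (a :: u)]/(size u).+1 -!(big_mkord xpredT (fun i => unfolds q (rot i _) : nat)).
  rewrite [LHS]big_nat_recr // [RHS]big_nat_recl // addnC rot0; congr (_ + _).
    by apply: eq_big_nat => i /= iu; rewrite -rotD ?addn1 //= ltnW.
  by rewrite -rotD ?addn1 // (rot_size (a :: u)).
case: (leqP k (size s)) => [|/ltnW/rot_oversize -> //].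
elim: k => [|k IH] ks; first by rewrite rot0.
by rewrite -add1n rotD // rot1E IH // ltnW.
Qed.

(** The rotation that starts with [x; y; x] comes back to its start. The one based at [y] is handled
    by [sum_pivot], the one based at the second [x] by [unfolds_tail], the others by
    [unfolds_pivot]. *)
Lemma nb_unfolds_backtrack q x y t : tailless q -> 2 < size q ->
  nb_unfolds q [:: x, y, x & t] = nb_unfolds q (x :: t).
Proof.
move=> tq q2; rewrite /nb_unfolds.
rewrite -!(big_mkord xpredT (fun i => unfolds q (rot i _) : nat)).
rewrite !big_nat_recl //.
have -> : unfolds q (rot 0 [:: x, y, x & t]) = false.
  by rewrite rot0 /unfolds !above_cons /= eqxx andbF.
have -> : rot 1 [:: x, y, x & t] = [:: y, x & rcons t x] by rewrite /rot /= cats1.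
have -> : rot 2 [:: x, y, x & t] = x :: t ++ [:: x; y] by [].
rewrite unfolds_tail // rot0 -(sum_pivot x y t tq q2) add0n addnCA; congr (_ + _).
rewrite -(big_mkord xpredT (fun i => pivot q x y t i : nat)) -big_split /=.
apply: eq_big_nat => i /= it.
by rewrite (unfolds_pivot q x y it) addnC.
Qed.
End Unfolding.

(** * Geodesic cyclic sequences *)

Section Geodesic.
Local Open Scope nat_scope.
Variable X : finType.
Implicit Types (x y z : X) (p q b c s t : seq X).

(** A vertex of the cover is a path read backwards, so this is the end of the lift of the closed
    path when that path is reduced. *)
Definition closed_end s : seq X :=
  if s is y :: s' then rev (y :: rcons s' y) else [::].

Definition geodesic_seq s : bool :=
  cycle [rel a b : X * X | b != (a.2, a.1)] (zip s (rot 1 s)).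

Lemma closed_end_inj s t : s != [::] -> t != [::] ->
  closed_end s = closed_end t -> s = t.
Proof.
case: s t => [//|x s] [//|y t] _ _ /(can_inj revK).
by rewrite -!rcons_cons => /rcons_inj[-> ->].
Qed.

Lemma zip_rot (T U : Type) i (s : seq T) (t : seq U) : size s = size t ->
  zip (rot i s) (rot i t) = rot i (zip s t).
Proof.
move=> st; have dst : size (drop i s) = size (drop i t) by rewrite !size_drop st.
have tst : size (take i s) = size (take i t) by rewrite !size_take_min st.
rewrite -{2}(cat_take_drop i s) -{2}(cat_take_drop i t) zip_cat // /rot zip_cat //.
case: (leqP i (size s)) => is_.
  rewrite drop_size_cat ?take_size_cat // size_zip -tst minnn size_takel //.
rewrite !(drop_oversize (n := i)) ?take_oversize ?cats0 //; do ?rewrite -st ltnW //.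
all: by rewrite ?size_zip -?st ?minnn ltnW.
Qed.

Lemma geodesic_seq_rot i s : geodesic_seq (rot i s) = geodesic_seq s.
Proof.
by rewrite /geodesic_seq rot_rot zip_rot ?size_rot // rot_cycle.
Qed.

Lemma path_reduced x y c :
  path [rel a b : X * X | b != (a.2, a.1)] (x, y) (zip (belast y c) c) =
  reduced [:: x, y & c].
Proof.
elim: c x y => // z c IH x y; rewrite /= in IH *; rewrite IH.
by rewrite xpair_eqE eqxx /= eq_sym.
Qed.

(** Repeating the first two vertices at the end makes the cyclic condition, tail included, a linear
    one. *)
Lemma geodesic_seqE x y s :
  geodesic_seq [:: x, y & s] = reduced ([:: x, y & s] ++ [:: x; y]).
Proof.
rewrite /geodesic_seq -[_ ++ _]/[:: x, y & s ++ [:: x; y]] -path_reduced.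
rewrite /= -[[:: x; y]]/(rcons [:: x] y) -rcons_cat cats1 belast_rcons.
by rewrite -zip_rcons ?size_rcons // rcons_cons.
Qed.

Lemma reduced_catr p q : reduced (p ++ q) -> reduced q.
Proof.
by elim: p => //= a [|b [|c p]] IH //=; case: q IH => //= [? [|? ?]] IH // /andP[_ /IH].
Qed.

Lemma reduced_catl p q : reduced (p ++ q) -> reduced p.
Proof.
elim: p => //= a [|b [|c p]] IH //= /andP[-> H]; exact: IH.
Qed.

(** A geodesic sequence lifts without cancellation to its own [closed_end], which determines it. *)
Lemma unfolds_geodesic s t : s != [::] -> t != [::] -> geodesic_seq s ->
  1 < size s -> unfolds (closed_end t) s = (s == t).
Proof.
case: s => [//|x [//|y s]] _ t0; rewrite geodesic_seqE => red _.
have {red} : reduced (x :: rcons (y :: s) x).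
  by apply: (@reduced_catl _ [:: y]); rewrite /= cat_rcons.
move/lift_end1_push => [e a]; rewrite /unfolds a e andbT.
apply/eqP/eqP => [|<-//]; exact: (@closed_end_inj [:: x, y & s]).
Qed.

Lemma geodesic_seq_tailless s : geodesic_seq s -> 1 < size s ->
  tailless (closed_end s) /\ 2 < size (closed_end s).
Proof.
case: s => [//|x [//|y s]]; rewrite geodesic_seqE => red _.
(* Two vertices alone form a cyclic sequence that backtracks. *)
case/lastP: s red => [|s u]; first by rewrite /= eqxx.
move=> red; split; last by rewrite /closed_end size_rev /= size_rcons.
have yu : y != u.
  have := @reduced_catr [:: x, y & s] [:: u; x; y].
  rewrite /= in red *; rewrite cat_rcons in red; move/(_ red).
  by rewrite andbT eq_sym.
move=> p x' y' z u' r; rewrite /closed_end rev_cons -!rcons_cons rev_rcons rev_rcons.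
rewrite rev_cons -[[:: x'; y']]/(rcons [:: x'] y') -rcons_cat cats1.
rewrite -!rcons_cons => e1 [_ <- _].
by have := congr1 (fun l => nth x (rev l) 1) e1; rewrite !rev_rcons /= => <-.
Qed.

End Geodesic.

(** * Periods of a cyclic sequence *)

Section Periods.
Local Open Scope nat_scope.
Variable T : eqType.
Implicit Types s u v : seq T.

Lemma commuting_power u v k : u != [::] -> u ++ v = v ++ u ->
  size v = k * size u -> v = flatten (nseq k u).
Proof.
move=> u0; elim: k v => [|k IH] v e sv; first by case: v sv {e}.
have uv : size u <= size v by rewrite sv mulSn leq_addr.
have ev : v = u ++ drop (size u) v.
  have := congr1 (take (size u)) e; rewrite take_size_cat // takel_cat // => {1}->.
  by rewrite cat_take_drop.
rewrite {1}ev /=; congr (_ ++ _); apply: IH.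
  move: e; rewrite {1 2}ev -catA => /eqP; rewrite eqseq_cat // => /andP[_ /eqP].
  by rewrite -ev.
by rewrite size_drop sv mulSn addKn.
Qed.

(** [d] is the least positive rotation fixing [s]; by Euclidean division the others are its
    multiples. *)
Lemma rot_period s : s != [::] -> exists d k, [/\ 0 < d, size s = k * d,
  s = flatten (nseq k (take d s)) &
  forall i, i <= size s -> (rot i s == s) = (d %| i)].
Proof.
move=> s0; have ex : exists d, (0 < d) && (rot d s == s).
  by exists (size s); rewrite rot_size eqxx andbT lt0n size_eq0.
have [d /andP[d0 /eqP ds] dmin] := ex_minnP ex.
have dle : d <= size s.
  by apply: dmin; rewrite rot_size eqxx andbT lt0n size_eq0.
have rotk k : k * d <= size s -> rot (k * d) s = s.
  elim: k => [|k IH]; first by rewrite mul0n rot0.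
  rewrite mulSn => kd; rewrite rotD // IH //; apply: leq_trans kd; exact: leq_addl.
have rotE i : i <= size s -> (rot i s == s) = (d %| i).
  move=> is_; apply/eqP/idP => [|/dvdnP[k ek]]; last by rewrite ek rotk // -ek.
  rewrite {1}(divn_eq i d) addnC rotD; last by rewrite addnC -divn_eq.
  rewrite rotk; last exact: leq_trans (leq_divM _ _) is_.
  move=> er; rewrite /dvdn -leqn0 leqNgt; apply/negP => r0.
  have := dmin (i %% d); rewrite r0 er eqxx => /(_ isT).
  by rewrite leqNgt ltn_mod d0.
have /dvdnP[k ek] : d %| size s by rewrite -rotE // rot_size.
exists d, k; split => //; rewrite -{1}(cat_take_drop d s).
case: k ek => [/eqP|k ek]; first by rewrite mul0n size_eq0 (negbTE s0).
rewrite /=; congr (_ ++ _); apply: commuting_power.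
- by rewrite -size_eq0 size_takel // -lt0n.
- by rewrite cat_take_drop; exact: esym.
- by rewrite size_drop size_takel // ek mulSn addKn.
Qed.

Lemma rot_flatten_nseq m u : 0 < m ->
  rot (size u) (flatten (nseq m u)) = flatten (nseq m u).
Proof.
case: m => // m _; rewrite /= rot_size_cat.
by elim: m => [|m IH] /=; rewrite ?cats0 // -catA IH.
Qed.

Lemma size_flatten_nseq m u : size (flatten (nseq m u)) = m * size u.
Proof. by elim: m => //= m IH; rewrite size_cat IH mulSn. Qed.

(** Rotating the target by one only shifts the indices cyclically, so every based representative
    arises from equally many rotations. *)
Lemma sum_rot_eq s u : (exists i, rot i s = u) ->
  \sum_(i < size s) (rot i s == u) = \sum_(i < size s) (rot i s == s).
Proof.
case=> k; case: (leqP k (size s)) => [|/ltnW/rot_oversize -> <- //].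
elim: k u => [|k IH] u ks; first by rewrite rot0 => <-.
have s0 : 0 < size s by apply: leq_trans ks.
rewrite -add1n rotD // => <-; rewrite -(IH _ (ltnW ks) erefl).
case en: (size s) s0 => [//|n] _.
rewrite -!(big_mkord xpredT (fun i => (rot i s == _) : nat)).
rewrite [RHS]big_nat_recr // [LHS]big_nat_recl // rot0 addnC.
congr (_ + _).
  apply: eq_big_nat => i /= iin; rewrite -add1n rotD ?en ?add1n; last exact: leqW.
  by rewrite (inj_eq (@rot_inj 1 T)).
have e : rot 1 (rot n s) = s by rewrite -rotD add1n -en ?rot_size.
by rewrite -[X in (X == rot 1 _)]e (inj_eq (@rot_inj 1 T)).
Qed.

End Periods.

(** * Multiplicity and homotopy of loops *)

Section Loops.
Local Open Scope nat_scope.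
Variables (X : finType) (E : rel X).
Implicit Types (s t : based_loop E) (l : loop E).

Definition BasedLoop (u : seq X) (uP : (u != [::]) && cycle E u) : based_loop E :=
  exist _ u uP.

Lemma pi_rot i s t : rot i (val s) = val t -> \pi_(loop E) s = \pi_(loop E) t.
Proof. by move=> e; apply/eqmodP/asboolP; exists i. Qed.

Lemma loop_seq_pi s : exists i, loop_seq (\pi_(loop E) s) = rot i (val s).
Proof.
have /eqmodP/asboolP[i e] : \pi_(loop E) s = \pi_(loop E) (repr (\pi_(loop E) s)).
  by rewrite reprK.
by exists i.
Qed.

Lemma loop_seqP l : (loop_seq l != [::]) && cycle E (loop_seq l).
Proof. exact: (valP (repr l)). Qed.

Lemma cycle_flatten_nseq (m : nat) (u : seq X) : 0 < m -> u != [::] ->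
  cycle E (flatten (nseq m u)) -> cycle E u.
Proof.
case: u m => // x u [//|[|m]] _ _ /=; first by rewrite cats0.
by rewrite rcons_cat cat_path /= => /and3P[p1 p2 _]; rewrite rcons_path p1.
Qed.

(** Both sides are the length divided by the least period [d]: a repeated block has length a
    multiple of [d], and the prefix of length [d] attains the maximum. *)
Lemma loop_multE l : loop_mult l =
  \sum_(i < size (loop_seq l)) (rot i (loop_seq l) == loop_seq l).
Proof.
have /andP[] := loop_seqP l; rewrite /loop_mult.
set s := loop_seq l => s0 cs.
have [d [k [d0 sk sE rotE]]] := rot_period s0.
have k0 : 0 < k.
  by rewrite lt0n; apply: contra s0 => /eqP k0; rewrite -size_eq0 sk k0.
have -> : \sum_(i < size s) (rot i s == s) = k.
  rewrite (eq_bigr (fun i : 'I_(size s) => (d %| i) : nat)); last first.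
    by move=> i _; rewrite rotE // ltnW.
  rewrite -(big_mkord xpredT (fun i => (d %| i) : nat)).
  (* [divn_count_dvd] counts from 1 to the length, the sum from 0 to the length minus one; both
     extreme indices are multiples of [d]. *)
  have := divn_count_dvd d (size s); rewrite {1}sk mulnK // => ->.
  have := @big_nat_recl _ 0 addn (size s) 0 (fun i => (d %| i) : nat) isT.
  rewrite big_nat_recr //= dvdn0 (_ : d %| size s) ?sk ?dvdn_mull // => /eqP.
  by rewrite addnC eqn_add2l big_add1 /= => /eqP.
apply/eqP; rewrite eqn_leq; apply/andP; split.
  apply/bigmax_leqP => m /asboolP[t]; move: (nat_of_ord m) => {}m et.
  case: (posnP m) => [->//|m0].
  have tn : size s = m * size (val t) by rewrite et size_flatten_nseq.
  have ts : size (val t) <= size s by rewrite tn leq_pmull.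
  have /dvdnP[j ej] : d %| size (val t).
    by rewrite -rotE // [in X in rot _ X]et rot_flatten_nseq // -et.
  have j0 : 0 < j.
    case/andP: (valP t) => t0 _; rewrite lt0n; apply: contra t0 => /eqP j0.
    by rewrite -size_eq0 ej j0.
  move: tn; rewrite sk ej mulnA => /eqP; rewrite eqn_pmul2r // => /eqP ->.
  exact: leq_pmulr.
have ks : k < (size s).+1 by rewrite ltnS sk leq_pmulr.
have tP : (take d s != [::]) && cycle E (take d s).
  have t0 : take d s != [::].
    by apply: contra s0 => /eqP t0; rewrite sE t0; elim: (k).
  by rewrite t0 (@cycle_flatten_nseq k) // -sE.
apply: (@leq_bigmax_cond _ _ (fun m : 'I_(size s).+1 => m : nat) (Ordinal ks)).
by apply/asboolP; exists (BasedLoop tP).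
Qed.

Lemma loop_mult_gt0 l : 0 < loop_mult l.
Proof.
have /andP[s0 _] := loop_seqP l; rewrite loop_multE.
case: (loop_seq l) s0 => // x s _; rewrite big_ord_recl.
by rewrite -[nat_of_ord _]/0 rot0 eqxx.
Qed.

Lemma nb_unfolds_homotopic q l l' : tailless q -> 2 < size q ->
  homotopic l l' -> nb_unfolds q (loop_seq l) = nb_unfolds q (loop_seq l').
Proof.
move=> tq q2; elim => {l l'} [l l' | // | l l' _ -> // | l l' l'' _ -> _ -> //].
move=> [s [s' [x [y [t [es es' <- <-]]]]]].
have [i ->] := loop_seq_pi s; have [j ->] := loop_seq_pi s'.
by rewrite !nb_unfolds_rot es es' nb_unfolds_backtrack.
Qed.

(** A rotation brings the backtrack to the front, where [erase_backtrack] applies. *)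
Lemma erase_backtrack_pi s x y u v : val s = u ++ [:: x, y, x & v] ->
  exists2 s' : based_loop E, val s' = u ++ x :: v &
  homotopic (\pi_(loop E) s) (\pi_(loop E) s').
Proof.
move=> es; have /andP[_ cs] := valP s.
have c1 : cycle E ([:: x, y, x & v] ++ u) by rewrite cycle_catC -es.
have c2 : cycle E ((x :: v) ++ u) by move: c1; rewrite /= => /and3P[].
have P0 : (u ++ x :: v != [::]) && cycle E (u ++ x :: v).
  by rewrite cycle_catC c2 andbT; case: (u).
have P1 : (x :: v ++ u != [::]) && cycle E (x :: v ++ u) by rewrite c2.
have P2 : ([:: x, y, x & v ++ u] != [::]) && cycle E [:: x, y, x & v ++ u].
  by rewrite c1.
exists (BasedLoop P0) => //; apply: rst_step.
exists (BasedLoop P2), (BasedLoop P1), x, y, (v ++ u); split => //.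
  by apply/esym/(@pi_rot (size u)); rewrite /= es rot_size_cat.
by apply/esym/(@pi_rot (size u)); rewrite /= rot_size_cat.
Qed.

(** Induction on the length: if the closed path is reduced then [s] is [g]; otherwise a backtrack
    can be erased and the shorter sequence still unfolds to the same vertex. *)
Lemma unfolds_homotopic s g : geodesic_seq (val g) -> 1 < size (val g) ->
  unfolds (closed_end (val g)) (val s) ->
  homotopic (\pi_(loop E) s) (\pi_(loop E) g).
Proof.
move=> geo g1; have [tl q2] := geodesic_seq_tailless geo g1.
have [n] := ubnP (size (val s)); elim: n s => // n IH s sn us.
have /andP[s0 _] := valP s; have /andP[g0 _] := valP g.
case es: (val s) s0 => [//|y s'] _.
case: (boolP (reduced (y :: rcons s' y))) => [/lift_end1_push[e _]|].
  move: us; rewrite es /unfolds e => /andP[/eqP us _].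
  have /val_inj -> : val s = val g.
    by apply: closed_end_inj => //; rewrite es.
  exact: rst_refl.
case/reducedPn => [c1 [a [b [c2 ec]]]].
have shorter s1 : size (val s1) < size (val s) ->
    unfolds (closed_end (val g)) (val s1) ->
    homotopic (\pi_(loop E) s) (\pi_(loop E) s1) ->
    homotopic (\pi_(loop E) s) (\pi_(loop E) g).
  by move=> s1n u1 h; apply: rst_trans h _; apply: IH => //; apply: leq_trans s1n _.
(* A backtrack at the very beginning would take the lift back to its start. *)
have nc1 : c1 != [::].
  apply/eqP => c10; move: us; rewrite es /unfolds.
  rewrite c10 in ec; case: ec => <- ->.
  by rewrite !above_cons /= eqxx andbF.
case: c1 nc1 ec => // y' c1 _ [_ {y'}].
(* A backtrack that ends at the closing vertex is rotated to the front, and [unfolds_tail] covers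
   its removal. *)
case/lastP: c2 => [|c2 z] ec.
  have ey : s' = c1 ++ [:: a; b] /\ y = a.
    move: ec; rewrite -[[:: a; b; a]]/(rcons [:: a; b] a) -rcons_cat.
    by move/rcons_inj => [-> ->].
  case: ey => es' ya; rewrite ya es' in es.
  have er : rot (size c1).+1 (val s) = [:: a, b, a & c1].
    by rewrite es -[a :: _]/((a :: c1) ++ [:: a; b]) (rot_size_cat (a :: c1)).
  have P : ([:: a, b, a & c1] != [::]) && cycle E [:: a, b, a & c1].
    by rewrite -er rot_cycle; case/andP: (valP s) => _ ->; rewrite er.
  have [s1 es1 h] := @erase_backtrack_pi (BasedLoop P) a b [::] c1 erefl.
  apply: (shorter s1).
  - by rewrite es1 es /= size_cat /=; lia.
  - by rewrite es1; rewrite es unfolds_tail in us.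
  - by rewrite (@pi_rot (size c1).+1 s (BasedLoop P) er).
have ey : s' = c1 ++ [:: a, b, a & c2].
  move: ec; rewrite -!rcons_cons -rcons_cat.
  by move/rcons_inj => [->].
rewrite ey in es.
have [s1 es1 h] := @erase_backtrack_pi s a b (y :: c1) c2 es.
apply: (shorter s1) => //.
- by rewrite es1 es /= !size_cat /=; lia.
- by move: us; rewrite es1 es unfolds_backtrack => /andP[].
Qed.

End Loops.

(** * Uniqueness of the geodesic loop in a homotopy class *)

Section GeodesicLoops.
Local Open Scope nat_scope.
Variables (X : finType) (E : rel X).
Implicit Types (s t : based_loop E) (l : loop E) (g : geodesic_loop E).

Lemma loop_size_gt1 l : irreflexive E -> 1 < size (loop_seq l).
Proof.
move=> irr; have /andP[] := loop_seqP l.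
by case: (loop_seq l) => [//|x [|//]] /=; rewrite irr.
Qed.

Definition geodesic_end g : seq X := closed_end (loop_seq (val g)).

Lemma nb_unfolds_geodesic g l : irreflexive E -> homotopic l (val g) ->
  nb_unfolds (geodesic_end g) (loop_seq l) = loop_mult (val g).
Proof.
move=> irr h; have g1 := loop_size_gt1 (val g) irr.
have [tl q2] := geodesic_seq_tailless (valP g) g1.
rewrite (nb_unfolds_homotopic tl q2 h) loop_multE; apply: eq_bigr => i _.
have /andP[s0 _] := loop_seqP (val g).
rewrite unfolds_geodesic ?size_rot //; last by rewrite geodesic_seq_rot; exact: valP g.
by rewrite -size_eq0 size_rot size_eq0.
Qed.

(** The count attached to [g] is positive on [g'], so some rotation of [g'] unfolds to the end of
    [g]; being geodesic, it is the representative of [g]. *)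
Lemma homotopic_geodesic_inj g g' : irreflexive E ->
  homotopic (val g') (val g) -> g' = g.
Proof.
move=> irr h; apply: val_inj.
have := nb_unfolds_geodesic irr h; rewrite /nb_unfolds => cnt.
have : 0 < \sum_(i < size (loop_seq (val g')))
             unfolds (geodesic_end g) (rot i (loop_seq (val g'))).
  by rewrite cnt loop_mult_gt0.
rewrite lt0n sum_nat_eq0 negb_forall => /existsP[i].
rewrite eqb0 negbK /geodesic_end.
have /andP[s0 _] := loop_seqP (val g); have /andP[s0' _] := loop_seqP (val g').
rewrite unfolds_geodesic //; first last.
- by rewrite size_rot loop_size_gt1.
- by rewrite geodesic_seq_rot; exact: valP g'.
- by rewrite -size_eq0 size_rot size_eq0.
move=> /eqP e.
by rewrite -[LHS]reprK -[RHS]reprK; apply: (pi_rot e).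
Qed.

Lemma loop_geodesicP g l : irreflexive E ->
  loop_geodesic l = Some g <-> homotopic l (val g).
Proof.
move=> irr; rewrite /loop_geodesic; split.
  by case: xgetP => // o _ [g' h <-] [<-].
move=> h; case: xgetP; last by move=> /(_ (Some g)) []; exists g.
move=> o _ [g' h' <-].
congr Some; apply: homotopic_geodesic_inj => //.
apply: rst_trans h; exact: rst_sym.
Qed.

Lemma unfolds_loop_geodesic g s : irreflexive E ->
  unfolds (geodesic_end g) (val s) -> loop_geodesic (\pi_(loop E) s) = Some g.
Proof.
move=> irr u; apply/loop_geodesicP => //; rewrite -[val g]reprK.
by apply: unfolds_homotopic u; [exact: valP g | exact: loop_size_gt1].
Qed.

End GeodesicLoops.

(** * Sums of nonnegative families *)

Section Esum.
Local Open Scope ereal_scope.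
Variable R : realType.

Lemma ge0_esumZl (T : choiceType) (A : set T) (f : T -> \bar R) (k : R) :
  (0 <= k)%R -> (forall i, 0 <= f i) ->
  \esum_(i in A) (k%:E * f i) = k%:E * \esum_(i in A) f i.
Proof.
move=> k0 f0; rewrite /esum -ereal_supZl //; last first.
  apply/set0P; exists 0; exists set0; first exact: fsets_set0.
  by rewrite fsbig_set0.
congr ereal_sup; apply/seteqP; split => x /=.
  move=> [F AF <-]; exists (\sum_(i \in F) f i); first by exists F.
  by rewrite ge0_mule_fsumr.
move=> [_ [F AF <-] <-]; exists F => //.
by rewrite ge0_mule_fsumr.
Qed.

(** Meant for words that factor uniquely into two pieces. Finiteness of the second sum lets it be
    pulled out as a real scalar. *)
Lemma esum_imageX (S T U : choiceType) (A : set S) (B : set T)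
    (h : S * T -> U) (f : U -> R) (fa : S -> R) (fb : T -> R) :
  (forall a, 0 <= fa a)%R -> (forall b, 0 <= fb b)%R ->
  set_inj (A `*` B) h ->
  (forall a b, A a -> B b -> f (h (a, b)) = (fa a * fb b)%R) ->
  \esum_(b in B) (fb b)%:E \is a fin_num ->
  \esum_(u in h @` (A `*` B)) (f u)%:E =
  (\esum_(a in A) (fa a)%:E) * (\esum_(b in B) (fb b)%:E).
Proof.
move=> fa0 fb0 inj fM fin; rewrite esum_image //.
rewrite (eq_esum (b := fun k : S * T => (fa k.1)%:E * (fb k.2)%:E)); last first.
  by move=> [a b] [/= Aa Bb]; rewrite fM // EFinM.
rewrite -(@esum_esum _ _ _ A (fun=> B) (fun a b => (fa a)%:E * (fb b)%:E)); last first.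
  by move=> a b _ _; rewrite mule_ge0 // lee_fin.
under eq_esum do rewrite ge0_esumZl //.
rewrite -(fineK fin) [RHS]muleC -ge0_esumZl //.
  by apply: eq_esum => a _; rewrite muleC.
by rewrite fine_ge0 // esum_ge0 // => b _; rewrite lee_fin.
Qed.

Lemma esum_bigcup_trivIset (I T : choiceType) (K : set I) (J : I -> set T)
    (f : T -> \bar R) :
  trivIset [set: I] J -> (forall t, 0 <= f t) ->
  \esum_(t in \bigcup_(i in K) J i) f t = \esum_(i in K) \esum_(t in J i) f t.
Proof.
move=> tJ f0; rewrite esum_esum //; apply: reindex_esum; split.
- by move=> [i t] [/= Ki Jt]; exists i.
- move=> [i t] [i' t'] /set_mem[/= Ki Jt] /set_mem[/= Ki' Jt'] e.
  rewrite -e in Jt' *; congr pair; apply: (tJ i i') => //.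
  by exists t.
- by move=> t [i Ki Jt]; exists (i, t).
Qed.

End Esum.

(** * Path weights and Kraft's inequality *)

Section Weights.
Variables (R : realType) (X : finType) (C : X -> X -> R) (kappa : X -> R).
Hypothesis C_ge0 : forall x y, 0 <= C x y.
Hypothesis kappa_ge0 : forall x, 0 <= kappa x.
Local Notation P := (trans_prob C kappa).
Local Notation weight := (path_weight C kappa).
Implicit Types (x y z : X) (s t : seq X).

Lemma total_rate_ge0 x : 0 <= total_rate C kappa x.
Proof. by rewrite addr_ge0 // sumr_ge0. Qed.

Lemma trans_prob_ge0 x y : 0 <= P x y.
Proof. by rewrite divr_ge0 // total_rate_ge0. Qed.

Lemma sum_trans_prob x : \sum_(y : X) P x y <= 1.
Proof.
rewrite -mulr_suml; have := total_rate_ge0 x; rewrite le_eqVlt.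
(* A zero total rate gives zero transition probabilities, since [0^-1 = 0]. *)
case/predU1P => [<-|r0]; first by rewrite invr0 mulr0 ler01.
by rewrite ler_pdivrMr // mul1r lerDr.
Qed.

Lemma path_weight_nil y : weight y [::] = 1.
Proof. exact: big_nil. Qed.

Lemma path_weight_cons y z s : weight y (z :: s) = P y z * weight z s.
Proof. by rewrite /path_weight /= big_cons. Qed.

Lemma path_weight_cat y s t :
  weight y (s ++ t) = weight y s * weight (last y s) t.
Proof.
elim: s y => [|z s IH] y; first by rewrite path_weight_nil mul1r.
by rewrite cat_cons !path_weight_cons IH mulrA.
Qed.

Lemma path_weight_ge0 y s : 0 <= weight y s.
Proof. by apply: prodr_ge0 => a _; exact: trans_prob_ge0. Qed.

Definition prefix_free (S : seq (seq X)) :=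
  {in S &, forall s t, prefix s t -> s = t}.

(** Group the paths by first vertex [z]: the tails are again prefix-free, so each group weighs at
    most [P y z]. *)
Lemma kraft_step n y (Q : pred X) (S : seq (seq X)) :
  (forall z (S' : seq (seq X)), uniq S' -> {in S', forall s, (size s <= n)%N} ->
     prefix_free S' -> \sum_(s <- S') weight z s <= 1) ->
  uniq S -> {in S, forall s, (size s <= n.+1)%N} -> prefix_free S ->
  [::] \notin S -> {in S, forall s, Q (head y s)} ->
  \sum_(s <- S) weight y s <= \sum_(z | Q z) P y z.
Proof.
move=> IH uS sS pS nS QS; rewrite big_seq_cond.
rewrite (partition_big (head y) Q) /=; last by move=> s /andP[/QS].
apply: ler_sum => z Qz.
rewrite (eq_bigr (fun s => P y z * weight z (behead s))); last first.
  move=> [|z' s] /andP[/andP[sS' _] /eqP /= e]; first by rewrite sS' in nS.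
  by rewrite path_weight_cons e.
rewrite -mulr_sumr -[leRHS]mulr1 ler_wpM2l ?trans_prob_ge0 //.
under eq_bigl do rewrite andbT.
rewrite -big_seq_cond -big_filter -(big_map behead xpredT (weight z)).
have consS s : s \in [seq s <- S | head y s == z] -> s = z :: behead s /\ s \in S.
  rewrite mem_filter => /andP[/eqP e sS']; split=> //.
  by case: s e sS' => [_ sS'|a s /= ->//]; rewrite sS' in nS.
apply: IH.
- rewrite map_inj_in_uniq ?filter_uniq // => s t /consS[-> _] /consS[-> _] /= -> //.
- by move=> _ /mapP[s /consS[e sS'] ->]; have := sS _ sS'; rewrite e.
- move=> _ _ /mapP[s /consS[es sS'] ->] /mapP[t /consS[et tS'] ->] st.
  by have := pS _ _ sS' tS'; rewrite es et /= eqxx st => /(_ isT)[].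
Qed.

(** Prefix-free paths are disjoint events for the chain. The empty path, if present, is alone;
    otherwise [kraft_step] applies, by induction on the maximal length. *)
Lemma kraft y (S : seq (seq X)) : uniq S -> prefix_free S ->
  \sum_(s <- S) weight y s <= 1.
Proof.
suff H n : forall y (S : seq (seq X)), uniq S ->
    {in S, forall s, (size s <= n)%N} -> prefix_free S ->
    \sum_(s <- S) weight y s <= 1.
  move=> uS pS; apply: (H (\max_(s <- S) size s)%N) => // s sS.
  exact: (@leq_bigmax_seq _ S xpredT size).
elim: n => [|n IH] {}y {}S uS sS pS.
all: case: (boolP ([::] \in S)) => nS.
1,3: suff -> : S = [:: [::]] by rewrite big_seq1 path_weight_nil.
1,2: apply/perm_small_eq => //; apply: uniq_perm => // s; rewrite inE.
1,2: by apply/idP/eqP => [sS'|-> //]; apply/esym/pS => //; rewrite prefix0s.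
  rewrite big_seq big1 ?ler01 // => s sS'.
  by have := sS _ sS'; rewrite leqn0 size_eq0 => /eqP s0; rewrite -s0 sS' in nS.
apply: le_trans (sum_trans_prob y); apply: kraft_step uS sS pS nS _ => //.
Qed.

End Weights.

(** * Excursions and contours in the cover *)

Section Excursions.
Local Open Scope nat_scope.
Variables (X : finType) (E : rel X).
Implicit Types (x y z : X) (c s : seq X).

(* Closed paths at [y] whose lift, started from the edge [(x, y)], stays strictly
   above [x]; [k] counts the returns of the lift to its starting point. *)
Definition contour x y k : set (seq X) := [set c | [/\ path E y c,
  lift_end [:: y; x] c = [:: y; x], above 1 [:: y; x] c &
  count_mem [:: y; x] (lift_path [:: y; x] c) = k]].

Lemma lift_path_bottom p x c r : r \in lift_path (rcons p x) c ->
  exists r', r = rcons r' x.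
Proof.
elim: c p => //= z c IH p; have [q ->] := cover_step_bottom p x z.
by rewrite inE => /orP[/eqP ->|/IH//]; exists q.
Qed.

Lemma above1E y c : above 1 [:: y] c = ([:: y] \notin lift_path [:: y] c).
Proof.
apply/idP/idP => [/allP ab|ny]; first by apply/negP => /ab.
apply/allP => r rin; have [r' er] := lift_path_bottom (p := [::]) rin.
rewrite er size_rcons ltnS lt0n size_eq0; apply: contra ny => /eqP r0.
by rewrite -[[:: y]]/(rcons [::] y) -{1}r0 -er.
Qed.

Lemma first_visit p q c : q \in lift_path p c ->
  exists c1 c2, [/\ c = c1 ++ c2, lift_end p c1 = q &
                    count_mem q (lift_path p c1) = 1].
Proof.
elim: c p => //= z c IH p; rewrite inE; case: (altP (cover_step p z =P q)) => [<-|ne].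
  by move=> _; exists [:: z], c; rewrite /= eqxx.
rewrite eq_sym (negbTE ne) => /IH [c1 [c2 [-> e1 e2]]].
by exists (z :: c1), c2; rewrite /= e1 (negbTE ne) e2.
Qed.

Lemma count_last_gt0 p q c : c != [::] -> lift_end p c = q ->
  0 < count_mem q (lift_path p c).
Proof.
case/lastP: c => // c z _ e; rewrite /lift_path scanl_rcons -cats1 count_cat.
by rewrite -[foldl _ _ _]/(lift_end p (rcons c z)) e /= eqxx addn1.
Qed.

Lemma contour0 x y : contour x y 0 = [set [::]].
Proof.
apply/seteqP; split => [c [_ e _ cnt]|_ -> //].
by apply/eqP/negPn/negP => c0; have := count_last_gt0 c0 e; rewrite cnt.
Qed.

(** Cut at the first return of the lift to [[:: y; x]]. *)
Lemma contourS x y k :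
  contour x y k.+1 = (fun ab => ab.1 ++ ab.2) @` (contour x y 1 `*` contour x y k).
Proof.
apply/seteqP; split => [c [pc e ab cnt]|_ [[a b] /= [[pa ea aa ca] [pb eb ab cb]] <-]].
  have : [:: y; x] \in lift_path [:: y; x] c by rewrite -has_pred1 has_count cnt.
  move/first_visit => [c1 [c2 [ec e1 cnt1]]]; exists (c1, c2) => //=.
  have lc1 : last y c1 = y.
    by have [r] := lift_end_head [:: x] y c1; rewrite e1 => -[].
  move: pc e ab cnt; rewrite ec cat_path above_cat lift_end_cat lift_path_cat e1 lc1.
  rewrite count_cat cnt1 => /andP[p1 p2] e /andP[a1 a2] [cnt2].
  by split; split.
have la : last y a = y by have [r] := lift_end_head [:: x] y a; rewrite ea => -[].
split; rewrite ?cat_path ?above_cat ?lift_end_cat ?lift_path_cat ?ea ?la ?pa ?aa //.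
by rewrite count_cat ca cb.
Qed.

(** If the first factors had different lengths, the longer one would contain a second return. *)
Lemma contour_cat_inj x y k :
  set_inj (contour x y 1 `*` contour x y k) (fun ab => ab.1 ++ ab.2).
Proof.
have aux a b a' b' : contour x y 1 a -> contour x y 1 a' ->
    size a <= size a' -> a ++ b = a' ++ b' -> a = a' /\ b = b'.
  move=> [_ ea _ ca] [_ ea' _ ca'] sz e.
  have ea'' : a' = a ++ drop (size a) a'.
    have := congr1 (take (size a)) e; rewrite take_size_cat // takel_cat //.
    by move=> {1}->; rewrite cat_take_drop.
  have d0 : drop (size a) a' = [::].
    apply/eqP/negPn/negP => d0; move: ca' ea'; rewrite ea'' lift_path_cat lift_end_cat.
    rewrite count_cat ca ea add1n => -[cd] ed.
    by have := count_last_gt0 d0 ed; rewrite cd.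
  rewrite d0 cats0 in ea''; split=> //.
  by move: e; rewrite ea'' => /eqP; rewrite eqseq_cat // => /andP[_ /eqP].
move=> [a b] [a' b'] /set_mem[/= Ha Hb] /set_mem[/= Ha' Hb'] e.
case: (leqP (size a) (size a')) => [sz|/ltnW sz].
  by have [-> ->] := aux _ _ _ _ Ha Ha' sz e.
by have [-> ->] := aux _ _ _ _ Ha' Ha sz (esym e).
Qed.

(** Once the first step avoids [x], placing [x] under the starting point does not affect a lift that
    stops at its first return. *)
Lemma tree_excursionE x y : [set s | tree_excursion E x y s] = contour x y 1.
Proof.
have cntE s : lift_path [:: y; x] s = map (cat^~ [:: x]) (lift_path [:: y] s) ->
    count_mem [:: y; x] (lift_path [:: y; x] s) =
    count_mem [:: y] (lift_path [:: y] s).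
  move=> ->; rewrite count_map; apply: eq_count => r /=.
  by rewrite -[[:: y; x]]/([:: y] ++ [:: x]) !cats1 eqseq_rcons eqxx andbT.
(* Entry [i] of the lift is the position at time [i + 1]: a first return at the last time is absent
   from the lift of [s] and reached with [w]. *)
have idxE s w : ((index [:: y] (cover_lift y (rcons s w))).+1 == size (rcons s w)) =
    ([:: y] \notin lift_path [:: y] s) && (lift_end [:: y] (rcons s w) == [:: y]).
  rewrite /cover_lift scanl_rcons -cats1 index_cat -/(lift_path _ _) size_rcons eqSS.
  rewrite -/(lift_end [:: y] (rcons s w)).
  have ss : size (lift_path [:: y] s) = size s by exact: size_scanl.
  case: ifPn => [iny|niny] /=.
    by apply/negbTE; rewrite neq_ltn -ss index_mem iny.
  by rewrite ss; case: (lift_end [:: y] (rcons s w) == [:: y]); lia.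
apply/seteqP; split => s.
  rewrite /= => /and4P[ps s0 hs].
  case/lastP: s s0 ps hs => [//|s w] _ ps hs; rewrite idxE => /andP[ny /eqP le].
  (* [lift_path_base] needs two letters, which the starting position lacks, so the first step is
     treated separately with [hs]. *)
  have mapE : lift_path ([:: y] ++ [:: x]) (rcons s w) =
      map (cat^~ [:: x]) (lift_path [:: y] (rcons s w)).
    have := scanl_rcons (@cover_step X) [:: y] s w.
    case ec : (rcons s w) hs => [|z c] hs; first by case: (s) ec.
    move=> /= e.
    rewrite (negbTE hs); congr cons.
    apply: (lift_path_base (p := [:: z; y])).
    have -> : belast [:: z; y] (lift_path [:: z; y] c) = lift_path [:: y] s.
      move: e; rewrite lastI -/(lift_path _ _).
      by move/rcons_inj => [].
    by rewrite -above1E in ny.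
  split=> //.
  - by have := lift_end_base mapE; rewrite le.
  - rewrite (@above_base _ 0 [:: y] [:: x] _ mapE).
    apply/allP => r rin; have [r' ->] := lift_path_bottom (p := [::]) rin.
    by rewrite size_rcons.
  - rewrite cntE //; have := scanl_rcons (@cover_step X) [:: y] s w.
    rewrite -/(lift_path _ _) -/(lift_end _ _) => ->; rewrite le -cats1 count_cat /=.
    by rewrite eqxx addn0 addn1; congr S; apply/count_memPn.
case => ps e ab cnt.
have s0 : s != [::] by apply: contra_eq_neq cnt => ->.
have mapE := @lift_path_unbase _ y [::] [:: x] s ab.
have e' : lift_end [:: y] s = [:: y].
  have := lift_end_base (p := [:: y]) mapE; rewrite e.
  by move/(@cat_injr _ [:: y]).
rewrite cntE // in cnt.
case/lastP: s s0 ps e ab cnt mapE e' => // s w _ ps e ab cnt mapE e'.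
apply/and4P; split=> //; first by case: (s).
  case ec: (rcons s w) ab => [|z c]; first by case: (s) ec.
  by rewrite above_cons /=; case: (altP (z =P x)).
rewrite idxE e' eqxx andbT; move: cnt.
have := scanl_rcons (@cover_step X) [:: y] s w.
rewrite -/(lift_path _ _) -/(lift_end _ _) e' => ->; rewrite -cats1 count_cat /= eqxx.
by rewrite addn0 addn1 => -[] /count_memPn.
Qed.

End Excursions.

(** * Total weights of excursions, contours and unfoldings *)

Section Contours.
Variables (R : realType) (X : finType) (E : rel X).
Variables (C : X -> X -> R) (kappa : X -> R).
Hypothesis C_ge0 : forall x y, 0 <= C x y.
Hypothesis kappa_ge0 : forall x, 0 <= kappa x.
Local Notation P := (trans_prob C kappa).
Local Notation weight := (path_weight C kappa).
Local Notation rho := (rho E C kappa).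
Local Notation excursion_weight := (excursion_weight E C kappa).
Implicit Types (x y z : X) (p q c s : seq X).
Local Open Scope ereal_scope.

Let weight_ge0 y s : 0 <= (weight y s)%:E.
Proof. by rewrite lee_fin path_weight_ge0. Qed.

Lemma excursion_weight_ge0 x y : 0 <= excursion_weight x y.
Proof. by apply: esum_ge0 => s _; exact: weight_ge0. Qed.

Lemma excursion_weight_le x y :
  excursion_weight x y <= (\sum_(z | z != x) P y z)%:E.
Proof.
apply: ge_ereal_sup => _ [F [finF FS] <-].
rewrite fsbig_finite //= sumEFin lee_fin.
pose S : seq (seq X) := finmap.enum_fset (fset_set F).
have SF s : s \in S -> contour E x y 1 s.
  by rewrite in_fset_set // inE -tree_excursionE => /FS.
(* An excursion properly extending another one would return twice. *)
have pS : prefix_free S.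
  move=> s t /SF Hs /SF Ht /prefixP[u et]; rewrite et in Ht *.
  case: (Hs) => ps es as_ cs; case: (Ht) => pt + at_ ct.
  rewrite lift_end_cat es => eu; move: ct; rewrite lift_path_cat count_cat cs es add1n.
  move=> -[cu]; case: u et eu cu {pt at_ Ht} => [|z u] et eu cu; first by rewrite cats0.
  by have := count_last_gt0 (isT : z :: u != [::]) eu; rewrite cu.
apply: (@kraft_step _ _ _ _ _ _ (\max_(s <- S) size s)%N) => //.
- by move=> z S' uS' _ pS'; exact: kraft.
- exact: finmap.fset_uniq.
- by move=> s sS; apply: leqW; exact: (@leq_bigmax_seq _ S xpredT size).
- by apply/negP => /SF[_ _ _].
- by move=> s /SF; rewrite -tree_excursionE => /and4P[].
Qed.

Lemma excursion_weight_lt1 x y : (0 < P y x)%R -> excursion_weight x y < 1.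
Proof.
move=> Pyx; apply: le_lt_trans (excursion_weight_le x y) _.
rewrite lte_fin; apply: lt_le_trans (sum_trans_prob C_ge0 kappa_ge0 y).
by rewrite [ltRHS](bigD1 x) //= ltrDr.
Qed.

Lemma excursion_weight_fin x y : excursion_weight x y \is a fin_num.
Proof.
rewrite ge0_fin_numE ?excursion_weight_ge0 //.
by apply: le_lt_trans (excursion_weight_le x y) _; rewrite ltry.
Qed.

Lemma rho_ge0 x y : 0 <= rho x y.
Proof. by apply: nneseries_ge0 => n _ _; rewrite expe_ge0 ?excursion_weight_ge0. Qed.

Lemma rho_fin x y : (0 < P y x)%R -> rho x y \is a fin_num.
Proof.
move=> Pyx; rewrite ge0_fin_numE ?rho_ge0 // /rho.
have := excursion_weight_lt1 Pyx; have := excursion_weight_ge0 x y.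
rewrite -(fineK (excursion_weight_fin x y)).
move: (fine _) => r; rewrite lee_fin lte_fin => r0 r1.
apply: (@le_lt_trans _ _ ((1 - r)^-1)%:E); last exact: ltry.
apply: lime_le.
  by apply: is_cvg_nneseries => n _ _; rewrite expe_ge0 // lee_fin.
apply: nearW => n; under eq_bigr do rewrite -EFin_expe.
rewrite sumEFin lee_fin -[leRHS]mul1r ler_pdivlMr ?subr_gt0 //.
rewrite big_mkord mulrC -opprB mulNr -subrX1 opprB.
by rewrite gerBl exprn_ge0.
Qed.

(** A contour with [k] returns is uniquely a concatenation of [k] excursions. *)
Lemma esum_contour x y k :
  \esum_(c in contour E x y k) (weight y c)%:E = excursion_weight x y ^+ k.
Proof.
elim: k => [|k IH].
  by rewrite contour0 esum_set1 // path_weight_nil expe0.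
rewrite contourS.
rewrite (@esum_imageX _ _ _ _ _ _ _ _ (weight y) (weight y)) //.
- by rewrite IH expeS /excursion_weight tree_excursionE.
- by move=> a; exact: path_weight_ge0.
- by move=> a; exact: path_weight_ge0.
- exact: contour_cat_inj.
- move=> a b [_ ea _ _] _; rewrite path_weight_cat.
  by have [r] := lift_end_head [:: x] y a; rewrite ea => -[<-].
- by rewrite IH fin_numX ?excursion_weight_fin.
Qed.

Lemma esum_contours x y :
  \esum_(c in \bigcup_k contour E x y k) (weight y c)%:E = rho x y.
Proof.
rewrite nneseries_sum_bigcup //; first by apply: eq_eseriesr => k _; exact: esum_contour.
by apply/trivIsetP => i j _ _ ij; apply/seteqP; split => // c [[_ _ _ ci] [_ _ _ cj]];
  move: ij; rewrite -ci cj eqxx.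
Qed.

Definition unfolding y q : set (seq X) :=
  [set c | [/\ path E y c, lift_end [:: y] c = q & above 1 [:: y] c]].

Lemma unfolding1 y : unfolding y [:: y] = [set [::]].
Proof.
apply/seteqP; split => [c [_ e ab]|_ -> //].
by case/lastP: c e ab => // c z e; rewrite above_rcons e.
Qed.

(** Cut at the last exit from [y' :: r]: what follows the step to [z] stays above that vertex and,
    with [r] removed, is a contour over the edge from [y'] to [z]. *)
Lemma unfoldingS y z y' r : E y' z -> reduced [:: z, y' & r] ->
  unfolding y [:: z, y' & r] = (fun ab => ab.1 ++ z :: ab.2) @`
    (unfolding y (y' :: r) `*` \bigcup_k contour E y' z k).
Proof.
move=> Eyz red.
have push : cover_step (y' :: r) z = [:: z, y' & r].
  by case: r red => //= u r /andP[/negbTE ->].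
have last_c1 c : lift_end [:: y] c = y' :: r -> last y c = y'.
  by move=> e; have [r'] := lift_end_head [::] y c; rewrite e => -[].
apply/seteqP; split=> [c [pc ec ab]|_ [[c1 c2] /= [[p1 e1 a1] [k _ [p2 e2 a2 _]]] <-]].
  have [c1 [c2 [e e1 _ a2]]] := @last_exit_to _ [:: y] (y' :: r) z c isT ec.
  have e2 : lift_end [:: z, y' & r] c2 = [:: z, y' & r].
    by rewrite -{1}push -ec e lift_end_cat e1.
  have un : above (size r) (z :: [:: y'] ++ r) c2 by apply: above_le a2; exact: leqnSn.
  exists (c1, c2) => //=; move: pc ab; rewrite e cat_path (last_c1 _ e1) above_cat.
  case/andP=> p1 /= /andP[_ p2] /andP[a1 _]; split => //.
  exists (count_mem [:: z; y'] (lift_path [:: z; y'] c2)) => //; split => //.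
    have := lift_end_unbase un; rewrite -[z :: _]/[:: z, y' & r] e2.
    by rewrite -[[:: z, y' & r]]/([:: z; y'] ++ r) => /cat_injr.
  by rewrite -(@above_base _ 1 [:: z; y'] r c2 (lift_path_unbase un)) add1n.
have base := lift_path_base r (@belast_above _ 1 [:: z; y'] c2 isT a2).
split; first by rewrite cat_path p1 (last_c1 _ e1) /= Eyz.
  rewrite lift_end_cat e1 -[lift_end _ _]/(lift_end (cover_step (y' :: r) z) c2) push.
  by rewrite (lift_end_base base) e2.
rewrite above_cat a1 e1 above_cons push /=.
have := @above_base _ 1 _ _ _ base; rewrite a2; apply: above_le; exact: leq_addr.
Qed.

Lemma unfoldingS_inj y z y' r : reduced [:: z, y' & r] ->
  set_inj (unfolding y (y' :: r) `*` \bigcup_k contour E y' z k)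
          (fun ab => ab.1 ++ z :: ab.2).
Proof.
move=> red [a b] [a' b'].
have push : cover_step (y' :: r) z = [:: z, y' & r].
  by case: r red => //= u r /andP[/negbTE ->].
have exitb k c : contour E y' z k c ->
    above (size (y' :: r)) (y' :: r) (z :: c).
  move=> [_ _ a2 _]; rewrite above_cons push leqnn.
  have base := lift_path_base r (@belast_above _ 1 [:: z; y'] c isT a2).
  by have := @above_base _ 1 _ _ _ base; rewrite a2 add1n.
move=> /set_mem[/= [_ e1 _] [k _ /exitb ab]].
move=> /set_mem[/= [_ e1' _] [k' _ /exitb ab']] e.
have ea : a = a'.
  apply: (@last_exit_unique _ (size (y' :: r)) [:: y] _ _ _ _ _ _ e);
    by rewrite ?e1 ?e1'.
by move: e; rewrite ea => /eqP; rewrite eqseq_cat // => /andP[_ /eqP[->]].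
Qed.

(** Induction on the last edge of [c], which contributes its transition probability times the sum
    over contours, that is [rho]. *)
Lemma esum_unfolding y c : (forall x z, E x z -> 0 < P z x)%R ->
  path E y c -> reduced (y :: c) ->
  \esum_(s in unfolding y (rev (y :: c))) (weight y s)%:E =
  \prod_(a <- zip (belast y c) c) ((P a.1 a.2)%:E * rho a.1 a.2).
Proof.
move=> Pgt0; elim/last_ind: c => [|c z IH] pc red.
  by rewrite -[rev _]/[:: y] unfolding1 esum_set1 // path_weight_nil big_nil.
have red' : reduced (y :: c) by apply: (@reduced_catl _ _ [:: z]); rewrite /= cats1.
have [e _] := lift_end1_push red'.
have [r er] := lift_end_head [::] y c; rewrite e in er.
move: pc; rewrite rcons_path => /andP[pc Ez].
have redr : reduced [:: z, last y c & r].
  have [e2 _] := lift_end1_push red.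
  have : reduced (lift_end [:: y] (rcons c z)) by apply: lift_end_reduced.
  by rewrite e2 -rcons_cons rev_rcons er.
(* The reverse transition has positive probability, hence [rho] is finite, as [esum_imageX]
   requires. *)
have rf := rho_fin (Pgt0 _ _ Ez).
rewrite -rcons_cons rev_rcons er unfoldingS //.
rewrite (@esum_imageX _ _ _ _ _ _ _ _ (weight y)
  (fun b => P (last y c) z * weight z b)%R).
- under [X in _ * X]eq_esum do rewrite EFinM.
  rewrite ge0_esumZl ?trans_prob_ge0 // esum_contours -er IH //.
  by rewrite belast_rcons lastI zip_rcons ?size_belast // -cats1 big_cat big_seq1 /=.
- by move=> a; exact: path_weight_ge0.
- by move=> a; rewrite mulr_ge0 ?trans_prob_ge0 ?path_weight_ge0.
- exact: unfoldingS_inj.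
- move=> a b [_ ea _] _ /=; rewrite path_weight_cat path_weight_cons.
  by have [r'] := lift_end_head [::] y a; rewrite ea => -[<- _].
- under eq_esum do rewrite EFinM.
  by rewrite ge0_esumZl ?trans_prob_ge0 // esum_contours fin_numM.
Qed.

End Contours.

(** * From loops to based loops that unfold *)

Section LoopSums.
Variables (R : realType) (X : finType) (E : rel X).
Variables (C : X -> X -> R) (kappa : X -> R).
Hypothesis E_irr : irreflexive E.
Implicit Types (l : loop E) (g : geodesic_loop E) (s t : seq X).
Local Notation P := (trans_prob C kappa).

Definition cyclic_weight s : R := \prod_(a <- zip s (rot 1 s)) P a.1 a.2.

Lemma cyclic_weight_rot i s : cyclic_weight (rot i s) = cyclic_weight s.
Proof.
rewrite /cyclic_weight rot_rot zip_rot ?size_rot //.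
by apply: perm_big; rewrite perm_rot.
Qed.

(** Without [undup], a based loop would occur once for each of the [loop_mult l] rotations producing
    it. *)
Definition unfolding_rots g l : seq (seq X) :=
  undup [seq t <- [seq rot i (loop_seq l) | i <- iota 0 (size (loop_seq l))]
        | unfolds (geodesic_end g) t].

Lemma mem_unfolding_rots g l t : reflect
  (unfolds (geodesic_end g) t /\
   exists2 i, (i < size (loop_seq l))%N & rot i (loop_seq l) = t)
  (t \in unfolding_rots g l).
Proof.
rewrite mem_undup mem_filter; apply: (iffP andP) => -[u].
  by move=> /mapP[i]; rewrite mem_iota => /andP[_ il] e; split=> //; exists i.
move=> [i il e]; split=> //; apply/mapP; exists i; rewrite ?e //.
by rewrite mem_iota.
Qed.

(** Double counting: each of these based loops comes from [loop_mult l] rotations, and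
    [loop_mult (val g)] rotations unfold in all. *)
Lemma size_unfolding_rots g l : loop_geodesic l = Some g ->
  (size (unfolding_rots g l) * loop_mult l = loop_mult (val g))%N.
Proof.
move=> gl; have h : homotopic l (val g) by apply/loop_geodesicP.
rewrite -(nb_unfolds_geodesic E_irr h) {h gl}.
have -> : (size (unfolding_rots g l) * loop_mult l = \sum_(t <- unfolding_rots g l)
    \sum_(i < size (loop_seq l)) (rot i (loop_seq l) == t))%N.
  rewrite big_seq (eq_bigr (fun=> loop_mult l)).
    by rewrite -big_seq big_const_seq count_predT iter_addn addn0 mulnC.
  move=> t /mem_unfolding_rots[_ [i _ e]].
  by rewrite sum_rot_eq ?loop_multE //; exists i.
rewrite exchange_big /=; apply: eq_bigr => i _.
have -> : (\sum_(t <- unfolding_rots g l) (rot i (loop_seq l) == t) =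
    count_mem (rot i (loop_seq l)) (unfolding_rots g l))%N.
  by rewrite -sum1_count [RHS]big_mkcond /=; apply: eq_bigr => t _; rewrite eq_sym; case: eqP.
rewrite count_uniq_mem ?undup_uniq //; congr nat_of_bool.
apply/mem_unfolding_rots/idP => [[]//|u]; split=> //; by exists i.
Qed.

Local Open Scope ereal_scope.
Hypothesis C_ge0 : forall x y, (0 <= C x y)%R.
Hypothesis kappa_ge0 : forall x, (0 <= kappa x)%R.

(** The number of terms is the ratio of the multiplicities, which turns [1 / loop_mult (val g)] into
    [1 / loop_mult l]. *)
Lemma esum_unfolding_rots g l : loop_geodesic l = Some g ->
  \esum_(t in [set` unfolding_rots g l])
     (((loop_mult (val g))%:R^-1)%:E * (cyclic_weight t)%:E) =
  (loop_measure C kappa l)%:E.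
Proof.
move=> gl; rewrite esum_fset; [|exact: finite_seq|]; last first.
  move=> t _; rewrite mule_ge0 // lee_fin ?invr_ge0 ?ler0n //.
  by apply: prodr_ge0 => a _; exact: trans_prob_ge0.
rewrite -fsbig_seq ?undup_uniq //= big_seq.
rewrite (eq_bigr (fun=> ((loop_mult (val g))%:R^-1 * cyclic_weight (loop_seq l))%:E)).
  rewrite -big_seq sumEFin big_const_seq count_predT iter_addr addr0; congr EFin.
  rewrite -[LHS]mulr_natr /loop_measure -(size_unfolding_rots gl) natrM.
  have ml0 : (loop_mult l)%:R != 0%R :> R by rewrite pnatr_eq0 -lt0n loop_mult_gt0.
  have N0 : (size (unfolding_rots g l))%:R != 0%R :> R.
    have := loop_mult_gt0 (val g); rewrite -(size_unfolding_rots gl) muln_gt0.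
    by rewrite pnatr_eq0 -lt0n => /andP[].
  by rewrite -/(cyclic_weight (loop_seq l)) invfM mulrC !mulrA mulfV // mul1r.
move=> t /mem_unfolding_rots[_ [i _ <-]].
by rewrite cyclic_weight_rot EFinM.
Qed.

Lemma bigcup_unfolding_rots g :
  \bigcup_(l in [set l | loop_geodesic l = Some g]) [set` unfolding_rots g l] =
  [set t | unfolds (geodesic_end g) t /\ cycle E t].
Proof.
apply/seteqP; split => [t [l _ /mem_unfolding_rots[u [i _ e]]]|t [u ct]].
  by split=> //; rewrite -e rot_cycle; have /andP[] := loop_seqP l.
have t0 : t != [::] by case: (t) u.
have tP : (t != [::]) && cycle E t by rewrite t0.
have gl : loop_geodesic (\pi_(loop E) (BasedLoop tP)) = Some g.
  exact: unfolds_loop_geodesic.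
exists (\pi_(loop E) (BasedLoop tP)) => //=; apply/mem_unfolding_rots; split => //.
(* The representative is [t] rotated by [i]; a further rotation by [size t - i] recovers [t].
   Extreme values of [i] are set apart to keep the index below the length. *)
have [i ->] := loop_seq_pi (BasedLoop tP); rewrite size_rot /=.
case: (leqP (size t) i) => [/rot_oversize ->|it].
  by exists 0%N; rewrite ?rot0 // lt0n size_eq0.
case: (posnP i) => [->|i0]; first by exists 0%N; rewrite ?rot0 // lt0n size_eq0.
exists (size t - i)%N; first by rewrite -[ltnRHS]subn0 ltn_sub2l // (ltn_trans i0 it).
by rewrite -rotD subnK ?(ltnW it) // rot_size.
Qed.

(** A based loop belongs to a single class, so the sum over loops becomes a sum over based loops. *)
Lemma esum_loop_measure g :
  \esum_(l in [set l | loop_geodesic l = Some g]) (loop_measure C kappa l)%:E =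
  ((loop_mult (val g))%:R^-1)%:E *
  \esum_(t in [set t | unfolds (geodesic_end g) t /\ cycle E t]) (cyclic_weight t)%:E.
Proof.
rewrite -bigcup_unfolding_rots -ge0_esumZl; first last.
- by move=> t; rewrite lee_fin; apply: prodr_ge0 => a _; exact: trans_prob_ge0.
- by rewrite invr_ge0 ler0n.
rewrite esum_bigcup_trivIset.
- by apply: eq_esum => l gl; rewrite esum_unfolding_rots.
- apply/trivIsetP => l l' _ _ ll'; apply/seteqP; split => // t [].
  move=> /mem_unfolding_rots[_ [i _ ei]] /mem_unfolding_rots[_ [j _ ej]].
  case/eqP: ll'; rewrite -[l]reprK -[l']reprK.
  have tP : (t != [::]) && cycle E t.
    by rewrite -ei rot_cycle -size_eq0 size_rot size_eq0 loop_seqP.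
  by rewrite (@pi_rot _ _ i _ (BasedLoop tP) ei) (@pi_rot _ _ j _ (BasedLoop tP) ej).
- move=> t; rewrite mule_ge0 // lee_fin ?invr_ge0 ?ler0n //.
  by apply: prodr_ge0 => a _; exact: trans_prob_ge0.
Qed.

(** Based loops start with [y] and omit the closing vertex; paths omit the initial [y] and end with
    it. [belast y] matches the two. *)
Lemma esum_cyclic_weight g : (forall x z, E x z -> 0 < P z x)%R ->
  \esum_(t in [set t | unfolds (geodesic_end g) t /\ cycle E t]) (cyclic_weight t)%:E =
  \prod_(a <- loop_edges (val g)) ((P a.1 a.2)%:E * rho E C kappa a.1 a.2).
Proof.
move=> Pgt0; have := valP g; rewrite /geodesic /loop_edges /geodesic_end.
have g1 := loop_size_gt1 (val g) E_irr; have /andP[_ cg] := loop_seqP (val g).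
case eg : (loop_seq (val g)) g1 cg => [//|y [//|z s]] _ cg geo.
have rotE : rot 1 [:: y, z & s] = rcons (z :: s) y by rewrite rot1_cons.
have red : reduced (y :: rcons (z :: s) y).
  have := geodesic_seqE y z s; rewrite /geodesic_seq geo => /esym red.
  by apply: (@reduced_catl _ _ [:: z]); rewrite /= cat_rcons.
have -> : zip [:: y, z & s] (rot 1 [:: y, z & s]) =
    zip (belast y (rcons (z :: s) y)) (rcons (z :: s) y).
  by rewrite rotE belast_rcons.
rewrite -esum_unfolding //.
have lastc c : unfolding E y (rev (y :: rcons (z :: s) y)) c -> exists c', c = rcons c' y.
  move=> [_ ec _]; case/lastP: c ec => [|c w]; first by move/(congr1 size); rewrite size_rev.
  have [r ->] := lift_end_rcons_head [:: y] c w.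
  by rewrite -rcons_cons rev_rcons => -[-> _]; exists c.
rewrite (@reindex_esum _ _ _ (unfolding E y (rev (y :: rcons (z :: s) y))) _ (belast y)).
  apply: eq_esum => c /lastc[c' ->].
  by rewrite /cyclic_weight belast_rcons rot1_cons /path_weight belast_rcons.
split.
- move=> c Uc /=; have [c' ec'] := lastc _ Uc; case: Uc; rewrite ec' belast_rcons.
  by move=> pc ec ab; rewrite /unfolds ec ab eqxx.
- move=> c1 c2 /set_mem/lastc[c1' ->] /set_mem/lastc[c2' ->].
  by rewrite !belast_rcons => -[->].
- case=> [[]//|y' t [/andP[/eqP e ab] ct]].
  have yy : y' = y.
    have [r] := lift_end_bottom [::] y' (rcons t y').
    by rewrite -[rcons [::] y']/[:: y'] e /closed_end rev_cons => /rcons_inj[_ ->].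
  by rewrite yy in e ab ct *; exists (rcons t y); rewrite ?belast_rcons.
Qed.

Lemma geodesic_mean_fin g : (forall x z, E x z -> 0 < P z x)%R ->
  geodesic_mean C kappa (val g) \is a fin_num.
Proof.
move=> Pgt0; rewrite /geodesic_mean fin_numM //.
have : forall a, a \in loop_edges (val g) -> E a.1 a.2.
  rewrite /loop_edges; have /andP[_] := loop_seqP (val g).
  case: (loop_seq (val g)) => // y s; rewrite rot1_cons /cycle.
  rewrite -(belast_rcons y s y); move: (rcons s y) => c.
  elim: c y => //= z c IH y /andP[Eyz pc] a.
  by rewrite inE => /orP[/eqP ->//|/(IH _ pc)].
elim: (loop_edges (val g)) => [|a r IH] H; first by rewrite big_nil.
rewrite big_cons !fin_numM ?rho_fin // ?IH ?H ?Pgt0 ?H ?mem_head //.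
by move=> b br; apply: H; rewrite inE br orbT.
Qed.

End LoopSums.

(** * Poisson counts and conclusion *)

Lemma poisson_point_process_independent (d : measure_display)
    (Omega : measurableType d) (R : realType) (Pr : probability Omega R)
    (I T : choiceType) (mu : T -> R) (N : T -> Omega -> nat) (A : I -> set T) :
  poisson_point_process Pr mu N -> trivIset [set: I] A ->
  independent_variables Pr (fun i => point_count N (A i)).
Proof.
move=> [_ _ indep] tA; split=> [i|s B us mB].
  have [|meas _] := indep 1%N (fun=> A i); last exact: (meas ord0).
  by move=> j k _ _ _; rewrite [j]ord1 [k]ord1.
(* Independence concerns finite lists [s]; enumerating [s] reduces it to a family indexed by
   ordinals. *)
pose t := tnth (in_tuple s).
have tinj : injective t.
  move=> j k e; apply: val_inj; apply/eqP.
  have x0 : I by exact: t j.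
  rewrite -(nth_uniq x0 (ltn_ord j) (ltn_ord k) us).
  by rewrite -!(tnth_nth _ (in_tuple s)); apply/eqP.
have [|_ /(_ (index_enum 'I_(size s)) (fun j => B (t j)))] :=
    indep (size s) (fun j => A (t j)).
  by move=> j k _ _ jk; apply/tinj/tA.
move=> /(_ (index_enum_uniq _) (fun j => mB (t j))).
rewrite (big_tnth _ _ s) => <-; congr (Pr _).
apply/seteqP; split => w H i /= ii.
  by apply: H; exact: mem_tnth.
have [j ->] := tnthP (in_tuple s) i ii.
by apply: H; exact: mem_index_enum.
Qed.

Theorem proposition5
  (d : measure_display) (Omega : measurableType d) (R : realType)
  (Pr : probability Omega R)
  (X : finType) (E : rel X)
  (E_sym : symmetric E) (E_irr : irreflexive E)
  (E_conn : forall x y : X, connect E x y)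
  (C : X -> X -> R) (kappa : X -> R)
  (C_sym : forall x y : X, C x y = C y x)
  (C_gt0 : forall x y : X, E x y -> 0 < C x y)
  (C_eq0 : forall x y : X, ~~ E x y -> C x y = 0)
  (kappa_ge0 : forall x : X, 0 <= kappa x)
  (L : loop E -> Omega -> nat)
  (L_ppp : poisson_point_process Pr (loop_measure (E := E) C kappa) L) :
  let N (g : geodesic_loop E) : Omega -> \bar R :=
    point_count L [set l : loop E | loop_geodesic l = Some g] in
  independent_variables Pr N /\
  forall g : geodesic_loop E,
    (geodesic_mean C kappa (val g) < +oo)%E /\
    poisson_variable Pr (N g) (geodesic_mean C kappa (val g)).
Proof.
have C_ge0 x y : 0 <= C x y.
  by case: (boolP (E x y)) => [/C_gt0/ltW //|/C_eq0 ->].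
have P_gt0 x z : E x z -> 0 < trans_prob C kappa z x.
  move=> Exz; have Czx : 0 < C z x by apply: C_gt0; rewrite E_sym.
  rewrite divr_gt0 // (lt_le_trans Czx) // /total_rate (bigD1 x) //=.
  by rewrite addrCA lerDl addr_ge0 // sumr_ge0.
move=> N; split.
  apply: (poisson_point_process_independent L_ppp).
  (* A loop has at most one geodesic loop, so the counted sets are disjoint. *)
  by move=> g g' _ _ [l [/= -> [->]]].
move=> g; split.
  have : geodesic_mean C kappa (val g) \is a fin_num by exact: geodesic_mean_fin.
  by rewrite fin_numElt => /andP[].
have [_ /(_ [set l : loop E | loop_geodesic l = Some g]) pois _] := L_ppp.
by rewrite esum_loop_measure // esum_cyclic_weight // in pois.
Qed.
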